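(* Let $\bar\sigma\in\Sigma$. There exists a constant $c_{\varnothing}>0$ independent of $N$ such that for all $t\in[0,T]$ $$\|\widehat{x}_{\varnothing}(t)-\widehat{x}_{\bar\sigma}(t)\|_{P_{\bar\sigma}(t)}\le c_{\varnothing}\;\mathbb{E}\big[\|\mathcal{S}_\sigma-\mathcal{S}_{\bar\sigma}\|_1\big].$$
   Context: Let $T>0$, $n,m,r\in\mathbb{N}$, $B\in\mathbb{R}^{n,m}$, $C\in\mathbb{R}^{r,n}$, $x_0\in\mathbb{R}^n$ and $y\in L^2(0,T;\mathbb{R}^r)$. $\|\cdot\|$ is the Euclidean norm on vectors and the induced norm on matrices; for a symmetric positive definite matrix $M$ set $\|z\|_M^2=z^\top M z$. Uncertain parameters: $\Sigma_A,\Sigma_\Gamma,\Sigma_R,\Sigma_Q$ are nonempty finite subsets of Euclidean spaces, $\Sigma=\Sigma_A\times\Sigma_\Gamma\times\Sigma_R\times\Sigma_Q=\{\sigma_1,\dots,\sigma_N\}$ has $N$ elements and carries the uniform probability measure, so $\mathbb{E}[f(\sigma)]=\frac1N\sum_{k=1}^N f(\sigma_k)$. Each $\sigma=(\sigma_A,\sigma_\Gamma,\sigma_R,\sigma_Q)\in\Sigma$ determines a matrix $A_\sigma\in\mathbb{R}^{n,n}$ (depending only on $\sigma_A$) and symmetric positive definite matrices $\Gamma_\sigma\in\mathbb{R}^{n,n}$ (depending only on $\sigma_\Gamma$), $R_\sigma\in\mathbb{R}^{m,m}$ (depending only on $\sigma_R$), $Q_\sigma\in\mathbb{R}^{r,r}$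 (depending only on $\sigma_Q$). For a quadruple of matrices write $\mathcal{S}_\sigma=(A_\sigma,\Gamma_\sigma,R_\sigma,Q_\sigma)$; differences are componentwise and $\|(A,\Gamma,R,Q)\|_1=\|A\|+\|\Gamma\|+\|R\|+\|Q\|$. For every $\sigma\in\Sigma$, $\Pi_\sigma$ and $\widehat{x}_\sigma$ are the unique solutions on $[0,T]$ of $$\dot\Pi_\sigma=A_\sigma\Pi_\sigma+\Pi_\sigma A_\sigma^\top-\Pi_\sigma C^\top Q_\sigma^{-1}C\Pi_\sigma+BR_\sigma B^\top,\quad\Pi_\sigma(0)=\Gamma_\sigma,$$ $$\dot{\widehat{x}}_\sigma=A_\sigma\widehat{x}_\sigma+\Pi_\sigma C^\top Q_\sigma^{-1}(y-C\widehat{x}_\sigma),\quad\widehat{x}_\sigma(0)=x_0,$$ and $P_\sigma(t)=\Pi_\sigma^{-1}(t)$. Write $\widehat{x}_k=\widehat{x}_{\sigma_k}$. The estimator $\widehat{x}_\varnothing$ is $$\widehat{x}_\varnothing(t)=\mathbb{E}[\widehat{x}_\sigma(t)]=\frac1N\sum_{k=1}^N\widehat{x}_k(t).$$ ''Independent of $N$'' means that the constant does not depend on the number $N$ of parameters; it may depend on $T,B,C,x_0,y$ and on the matrices involved. *)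

(* Defs.v *)
From HB Require Import structures.
From mathcomp Require Import all_boot all_order all_algebra.
From mathcomp Require Import finmap.
From mathcomp Require Import all_classical all_reals all_analysis.

Set Implicit Arguments.
Unset Strict Implicit.
Unset Printing Implicit Defensive.

Import Order.TTheory GRing.Theory Num.Theory.
Import numFieldNormedType.Exports.

Local Open Scope classical_set_scope.
Local Open Scope ring_scope.

(* The library norm on matrices is the entrywise maximum, so the Euclidean norm
   and the operator norm it induces are introduced here. *)
Definition enorm2 (R : realType) (n : nat) (x : 'cV[R]_n) : R :=
  Num.sqrt (\sum_(i < n) x i 0 ^+ 2).

Definition opnorm2 (R : realType) (m n : nat) (M : 'M[R]_(m, n)) : R :=
  sup [set enorm2 (M *m x) | x in [set x : 'cV[R]_n | enorm2 x <= 1]].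

Definition wnorm (R : realType) (n : nat) (M : 'M[R]_n) (z : 'cV[R]_n) : R :=
  Num.sqrt ((z^T *m M *m z) 0 0).

Definition spd (R : realType) (n : nat) (M : 'M[R]_n) : Prop :=
  M^T = M /\ forall z : 'cV[R]_n, z != 0 -> 0 < (z^T *m M *m z) 0 0.

(* Quadruples (A, Gamma, R, Q); the product type carries the componentwise
   subtraction. *)
Definition quad (R : realType) (n m r : nat) : Type :=
  ('M[R]_n * 'M[R]_n * 'M[R]_m * 'M[R]_r)%type.

Definition norm1 (R : realType) (n m r : nat) (S : quad R n m r) : R :=
  let: (A, G, W, Q) := S in opnorm2 A + opnorm2 G + opnorm2 W + opnorm2 Q.

Definition admissible (R : realType) (n m r : nat) (S : quad R n m r) : Prop :=
  let: (A, G, W, Q) := S in [/\ spd G, spd W & spd Q].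

(* As K grows, these sets of admissible quadruples exhaust all admissible
   quadruples, and every compact set of admissible quadruples lies in one of
   them. *)
Definition bounded_quad (R : realType) (n m r : nat) (K : R)
    (S : quad R n m r) : Prop :=
  let: (A, G, W, Q) := S in
  [/\ opnorm2 A <= K,
      opnorm2 G <= K /\ opnorm2 (invmx G) <= K,
      opnorm2 W <= K /\ opnorm2 (invmx W) <= K &
      opnorm2 Q <= K /\ opnorm2 (invmx Q) <= K].

Definition square_integrable (R : realType) (T : R) (r : nat)
    (y : R -> 'cV[R]_r) : Prop :=
  (forall i : 'I_r, measurable_fun `[0, T] (fun t => y t i 0)) /\
  (\int[lebesgue_measure]_(t in `[0%R, T]) ((enorm2 (y t)) ^+ 2)%:E < +oo)%E.

(* Classical solution on [0, T]: continuity up to the endpoints together with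
   the equation on the open interval yields the one-sided derivatives at 0
   and T. *)
Definition riccati_solution (R : realType) (T : R) (n m r : nat)
    (B : 'M[R]_(n, m)) (C : 'M[R]_(r, n)) (S : quad R n m r)
    (Pi : R -> 'M[R]_n) : Prop :=
  let: (A, G, W, Q) := S in
  [/\ {within `[0, T], continuous Pi},
      Pi 0 = G &
      forall t : R, t \in `]0, T[ ->
        is_derive t 1 Pi
          (A *m Pi t + Pi t *m A^T
           - Pi t *m C^T *m invmx Q *m C *m Pi t + B *m W *m B^T)].

(* Since y is only square integrable, solutions are taken in the sense of
   Caratheodory: continuous functions satisfying the integrated equation, the
   integral being understood componentwise. *)
Definition observer_solution (R : realType) (T : R) (n m r : nat)
    (C : 'M[R]_(r, n)) (x0 : 'cV[R]_n) (y : R -> 'cV[R]_r)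
    (S : quad R n m r) (Pi : R -> 'M[R]_n) (x : R -> 'cV[R]_n) : Prop :=
  let: (A, G, W, Q) := S in
  {within `[0, T], continuous x} /\
  forall t : R, t \in `[0, T] -> forall i : 'I_n,
    x t i 0 = x0 i 0 +
      \int[lebesgue_measure]_(s in `[0, t])
        (A *m x s + Pi s *m C^T *m invmx Q *m (y s - C *m x s)) i 0.

Definition param (R : realType) (pA pG pW pQ : nat) : choiceType :=
  ('rV[R]_pA * 'rV[R]_pG * 'rV[R]_pW * 'rV[R]_pQ)%type.

Definition param_set (R : realType) (pA pG pW pQ : nat)
    (SA : {fset 'rV[R]_pA}) (SG : {fset 'rV[R]_pG})
    (SW : {fset 'rV[R]_pW}) (SQ : {fset 'rV[R]_pQ}) :
    {fset param R pA pG pW pQ} :=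
  (SA `*` SG `*` SW `*` SQ)%fset.

Definition quad_of (R : realType) (n m r pA pG pW pQ : nat)
    (A : 'rV[R]_pA -> 'M[R]_n) (G : 'rV[R]_pG -> 'M[R]_n)
    (W : 'rV[R]_pW -> 'M[R]_m) (Q : 'rV[R]_pQ -> 'M[R]_r)
    (s : param R pA pG pW pQ) : quad R n m r :=
  let: (sA, sG, sW, sQ) := s in (A sA, G sG, W sW, Q sQ).

(* Expectation for the uniform probability measure on a finite set. *)
Definition mean (R : realType) (V : lmodType R) (I : choiceType)
    (D : {fset I}) (f : I -> V) : V :=
  (#|` D|%fset%:R)^-1 *: \sum_(s <- D) f s.

(* Main.v *)
Require Import Defs.
From HB Require Import structures.
From mathcomp Require Import all_boot all_order all_algebra.
From mathcomp Require Import finmap.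
From mathcomp Require Import all_classical all_reals all_analysis.
From mathcomp Require Import measurable_realfun.
From mathcomp Require Import ring lra.

Set Implicit Arguments.
Unset Strict Implicit.
Unset Printing Implicit Defensive.

Import Order.TTheory GRing.Theory Num.Theory.
Import numFieldNormedType.Exports.

Local Open Scope classical_set_scope.
Local Open Scope ring_scope.

(** Everything reduces to a Lipschitz estimate for a pair of parameters: if the
    data of two parameters differ by [d], then their observers differ by at most
    [c * d] at every time, where [c] depends only on [T], [B], [C], [x0], [y] and
    the bound [K] on the data. Averaging this estimate over the first parameter
    gives the bound on the mean observer, and the weighted norm is at most a
    multiple of the plain one because the Riccati solutions are bounded below.

    The estimate needs bounds on the Riccati solutions that are uniform in the
    data, and these come from barriers ([psd_barrier], [riccati_qf_bounds]).
    Suppose that [Pi t] first touches [mu%:M] at time [t], where [mu] is a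
    decreasing exponential below or an increasing one above. A vector on which
    the two quadratic forms agree is then an eigenvector of [Pi t] for [mu], and
    along it the right-hand side of the equation has the value
    [2 * mu * qf A z - mu ^+ 2 * qf (C^T Q^-1 C) z + qf (B W B^T) z].
    For a small [mu] this is at least a constant times [- mu * dot z z], for a
    large [mu] it is at most a constant times [mu * dot z z], and both constants
    depend only on bounds for the data. A barrier of larger rate therefore cannot be
    crossed. Symmetry of [Pi t], which the argument uses, follows from
    uniqueness ([riccati_sym]).

    With these bounds the right-hand sides are Lipschitz in the data and in the
    unknown. Constants are propagated through the matrix expressions by the
    relation [close], and Gronwall's inequality concludes: in differential form
    for the Riccati equations ([gronwall_mx], [riccati_lipschitz]), in integral
    form for the observers ([gronwall_caratheodory], [observer_lipschitz]), where
    [y] enters only through the integral of its size. The work is done with the maximum norm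
    of matrices, which is dominated by the operator norm
    ([mx_norm_le_opnorm2]). *)

(** * Maximum norm, Euclidean norm and operator norm *)

Section MatrixNorms.
Context {R : realType}.

Lemma ler_mx_norm_entry p q (M : 'M[R]_(p, q)) i j : `|M i j| <= `|M|.
Proof.
by rewrite [leRHS]/Num.Def.normr/= mx_normrE; exact: (le_bigmax _ _ (i, j)).
Qed.

Lemma mx_norm_le p q (M : 'M[R]_(p, q)) c :
  0 <= c -> (forall i j, `|M i j| <= c) -> `|M| <= c.
Proof.
move=> c0 Mc; rewrite [leLHS]/Num.Def.normr/= mx_normrE.
by apply: bigmax_le => // -[i j] _; exact: Mc.
Qed.

Lemma mx_norm_tr p q (M : 'M[R]_(p, q)) : `|M^T| = `|M|.
Proof.
apply/eqP; rewrite eq_le; apply/andP; split; apply: mx_norm_le => // i j.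
  by rewrite mxE ler_mx_norm_entry.
by have := ler_mx_norm_entry M^T j i; rewrite mxE.
Qed.

Lemma sumr_const_ord q (a : R) : \sum_(k < q) a = q%:R * a.
Proof. by rewrite sumr_const card_ord mulr_natl. Qed.

Lemma mx_normM_le p q s (M : 'M[R]_(p, q)) (N : 'M[R]_(q, s)) :
  `|M *m N| <= q%:R * `|M| * `|N|.
Proof.
apply: mx_norm_le => [|i j]; first by rewrite !mulr_ge0.
rewrite mxE (le_trans (ler_norm_sum _ _ _))//.
rewrite -mulrA -sumr_const_ord.
by apply: ler_sum => k _; rewrite normrM ler_pM// ler_mx_norm_entry.
Qed.

Lemma mx_normM_le2 p q s (M : 'M[R]_(p, q)) (N : 'M[R]_(q, s)) a b :
  `|M| <= a -> `|N| <= b -> `|M *m N| <= q%:R * a * b.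
Proof.
move=> Ma Nb; apply: (le_trans (mx_normM_le M N)).
by apply: ler_pM; rewrite ?mulr_ge0// ler_wpM2l.
Qed.

Definition dot n (x y : 'cV[R]_n) : R := (x^T *m y) 0 0.

Lemma dotE n (x y : 'cV[R]_n) : dot x y = \sum_i x i 0 * y i 0.
Proof. by rewrite /dot mxE; apply: eq_bigr => i _; rewrite mxE. Qed.

Lemma dotC n (x y : 'cV[R]_n) : dot x y = dot y x.
Proof. by rewrite !dotE; apply: eq_bigr => i _; rewrite mulrC. Qed.

Lemma dotDl n (x y z : 'cV[R]_n) : dot (x + y) z = dot x z + dot y z.
Proof. by rewrite /dot linearD mulmxDl mxE. Qed.

Lemma dotDr n (x y z : 'cV[R]_n) : dot z (x + y) = dot z x + dot z y.
Proof. by rewrite /dot mulmxDr mxE. Qed.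

Lemma dotZl n a (x y : 'cV[R]_n) : dot (a *: x) y = a * dot x y.
Proof. by rewrite /dot linearZ -scalemxAl mxE. Qed.

Lemma dotZr n a (x y : 'cV[R]_n) : dot x (a *: y) = a * dot x y.
Proof. by rewrite /dot -scalemxAr mxE. Qed.

Lemma dotNr n (x y : 'cV[R]_n) : dot x (- y) = - dot x y.
Proof. by rewrite /dot mulmxN mxE. Qed.

Lemma dotNl n (x y : 'cV[R]_n) : dot (- x) y = - dot x y.
Proof. by rewrite dotC dotNr dotC. Qed.

Lemma dot_trmx p q (M : 'M[R]_(p, q)) x y : dot x (M *m y) = dot (M^T *m x) y.
Proof. by rewrite /dot trmx_mul trmxK mulmxA. Qed.

Lemma dot_ge0 n (x : 'cV[R]_n) : 0 <= dot x x.
Proof. by rewrite dotE sumr_ge0// => i _; rewrite -expr2 sqr_ge0. Qed.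

Lemma dot_eq0 n (x : 'cV[R]_n) : (dot x x == 0) = (x == 0).
Proof.
apply/idP/eqP => [|->]; last by rewrite /dot mulmx0 mxE.
rewrite dotE psumr_eq0 => [/allP x0|i _]; last by rewrite -expr2 sqr_ge0.
apply/colP => i; have /implyP/(_ isT) := x0 i (mem_index_enum _).
by rewrite -expr2 sqrf_eq0 mxE => /eqP.
Qed.

Lemma dot_gt0 n (x : 'cV[R]_n) : x != 0 -> 0 < dot x x.
Proof. by move=> x0; rewrite lt_def dot_eq0 x0 dot_ge0. Qed.

Lemma enorm2E n (x : 'cV[R]_n) : enorm2 x = Num.sqrt (dot x x).
Proof. by rewrite /enorm2 dotE; under eq_bigr do rewrite expr2. Qed.

Lemma mx_norm_sqr_le_dot n (x : 'cV[R]_n) : `|x| ^+ 2 <= dot x x.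
Proof.
suff : `|x| <= Num.sqrt (dot x x).
  by move=> h; rewrite -[leRHS]sqr_sqrtr ?dot_ge0// ler_sqr ?nnegrE// sqrtr_ge0.
apply: mx_norm_le => [|i j]; first exact: sqrtr_ge0.
rewrite ord1 -sqrtr_sqr ler_sqrt ?dot_ge0// dotE (bigD1 i)//= -expr2 lerDl.
by rewrite sumr_ge0// => k _; rewrite -expr2 sqr_ge0.
Qed.

Lemma dot_le_mx_norm_sqr n (x : 'cV[R]_n) : dot x x <= n%:R * `|x| ^+ 2.
Proof.
rewrite dotE -sumr_const_ord.
apply: ler_sum => i _.
by rewrite -expr2 -real_normK ?num_real// ler_sqr ?nnegrE// ler_mx_norm_entry.
Qed.

Lemma mx_norm_le_enorm2 n (x : 'cV[R]_n) : `|x| <= enorm2 x.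
Proof.
rewrite enorm2E -(@ler_sqr _ `|x|) ?nnegrE ?sqrtr_ge0// sqr_sqrtr ?dot_ge0//.
exact: mx_norm_sqr_le_dot.
Qed.

Lemma enorm2_le_mx_norm n (x : 'cV[R]_n) : enorm2 x <= Num.sqrt n%:R * `|x|.
Proof.
have -> : `|x| = Num.sqrt (`|x| ^+ 2) by rewrite sqrtr_sqr normr_id.
rewrite enorm2E -sqrtrM//.
by rewrite ler_sqrt ?mulr_ge0// ?sqr_ge0// dot_le_mx_norm_sqr.
Qed.

Lemma enorm2_delta n (i : 'I_n) : enorm2 (delta_mx i 0 : 'cV[R]_n) = 1.
Proof.
rewrite enorm2E dotE (bigD1 i)//= mxE !eqxx mulr1 big1 ?addr0 ?sqrtr1//.
by move=> j /negbTE ji; rewrite mxE ji mul0r.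
Qed.

(** The supremum defining the operator norm is one of a bounded set, hence
    bounds each of its elements; evaluating at basis vectors reaches the
    entries of the matrix. *)
Lemma mx_norm_le_opnorm2 p q (M : 'M[R]_(p, q)) : `|M| <= opnorm2 M.
Proof.
have ubM : has_ubound [set enorm2 (M *m x) | x in [set x | enorm2 x <= 1]].
  exists (Num.sqrt p%:R * (q%:R * `|M| * 1)) => _ /= [x x1 <-].
  apply: (le_trans (enorm2_le_mx_norm _)); rewrite ler_wpM2l ?sqrtr_ge0//.
  by apply: mx_normM_le2 => //; exact: (le_trans (mx_norm_le_enorm2 x)).
have elt x : enorm2 x <= 1 -> enorm2 (M *m x) <= opnorm2 M.
  by move=> x1; apply: ub_le_sup => //; exists x.
apply: mx_norm_le => [|i j].
  apply: le_trans (elt 0 _); first by rewrite enorm2E sqrtr_ge0.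
  by rewrite enorm2E /dot mulmx0 mxE sqrtr0.
have := elt (delta_mx j 0); rewrite enorm2_delta => /(_ (lexx _)).
apply: le_trans; apply: le_trans (mx_norm_le_enorm2 _).
by rewrite -colE; have := ler_mx_norm_entry (col j M) i 0; rewrite mxE.
Qed.

Lemma opnorm2_ge0 p q (M : 'M[R]_(p, q)) : 0 <= opnorm2 M.
Proof. exact: le_trans (mx_norm_le_opnorm2 M). Qed.

(** * Propagation of bounds and distances *)

(** The invariant of all the Lipschitz estimates. A product is Lipschitz only on
    bounded sets, so the size bounds travel with the distance bound; sharing one
    constant makes the relation stable under the matrix operations, with a
    constant that depends only on those of the operands. *)
Definition close (c d : R) p q (M M' : 'M[R]_(p, q)) : Prop :=
  [/\ `|M| <= c, `|M'| <= c & `|M - M'| <= c * d].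

Lemma close_refl d p q (M : 'M[R]_(p, q)) : 0 <= d -> close `|M| d M M.
Proof. by move=> d0; split=> //; rewrite subrr normr0 mulr_ge0. Qed.

Lemma closeD c c' d p q (M M' N N' : 'M[R]_(p, q)) :
  close c d M M' -> close c' d N N' -> close (c + c') d (M + N) (M' + N').
Proof.
move=> [Mc M'c MM'] [Nc N'c NN']; split; last 1 first.
- rewrite opprD addrACA mulrDl.
  exact: le_trans (ler_normD _ _) (lerD MM' NN').
- exact: le_trans (ler_normD _ _) (lerD Mc Nc).
- exact: le_trans (ler_normD _ _) (lerD M'c N'c).
Qed.

Lemma closeN c d p q (M M' : 'M[R]_(p, q)) :
  close c d M M' -> close c d (- M) (- M').
Proof. by move=> [? ? ?]; split; rewrite -?opprD normrN. Qed.

Lemma close_tr c d p q (M M' : 'M[R]_(p, q)) :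
  close c d M M' -> close c d M^T M'^T.
Proof. by move=> [? ? ?]; split; rewrite -?linearB mx_norm_tr. Qed.

Lemma closeM c c' d p q s (M M' : 'M[R]_(p, q)) (N N' : 'M[R]_(q, s)) :
  close c d M M' -> close c' d N N' ->
  close (q%:R * c * c' *+ 2) d (M *m N) (M' *m N').
Proof.
move=> [Mc M'c MM'] [Nc N'c NN'].
have c0 : 0 <= c by exact: le_trans Mc.
have c'0 : 0 <= c' by exact: le_trans Nc.
have h : q%:R * c * c' <= q%:R * c * c' *+ 2.
  by rewrite mulr2n lerDl !mulr_ge0.
split; [exact: le_trans (mx_normM_le2 Mc Nc) h|
        exact: le_trans (mx_normM_le2 M'c N'c) h|].
have -> : M *m N - M' *m N' = (M - M') *m N + M' *m (N - N').
  by rewrite mulmxBl mulmxBr addrA subrK.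
apply: (le_trans (ler_normD _ _)).
rewrite (_ : _ * d = q%:R * (c * d) * c' + q%:R * c * (c' * d)); last by ring.
by apply: lerD; exact: mx_normM_le2.
Qed.

Lemma close_le c d c' d' p q (M M' : 'M[R]_(p, q)) : 0 <= d ->
  c <= c' -> d <= d' -> close c d M M' -> close c' d' M M'.
Proof.
move=> d0 cc' dd' [Mc M'c MM']; split; [exact: le_trans cc'|exact: le_trans cc'|].
apply: (le_trans MM'); apply: ler_pM => //; exact: le_trans Mc.
Qed.

(** The resolvent identity. *)
Lemma close_inv c d n (M M' : 'M[R]_n) : 0 <= d -> 1 <= c ->
  M \in unitmx -> M' \in unitmx -> `|invmx M| <= c -> `|invmx M'| <= c ->
  `|M - M'| <= d -> close (c + n%:R * (n%:R * c) * c) d (invmx M) (invmx M').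
Proof.
move=> d0 c1 uM uM' Mc M'c MM'.
have c0 : 0 <= c by exact: le_trans c1.
have p0 : 0 <= n%:R * (n%:R * c) * c :> R by rewrite !mulr_ge0.
split; [by rewrite (le_trans Mc)// lerDl|by rewrite (le_trans M'c)// lerDl|].
have -> : invmx M - invmx M' = invmx M *m (M' - M) *m invmx M'.
  by rewrite mulmxBr mulmxBl mulVmx// mul1mx mulmxK.
apply: (@le_trans _ _ (n%:R * (n%:R * c * d) * c)).
  by do 2?apply: mx_normM_le2 => //; rewrite distrC.
rewrite mulrDl -[leLHS]add0r lerD ?mulr_ge0// le_eqVlt; apply/orP; left.
by apply/eqP; ring.
Qed.

End MatrixNorms.

(** * Limits and derivatives of matrix-valued functions *)

Section MatrixFunctions.
Context {R : realType}.

Lemma cvg_mxP (U : Type) (F : set_system U) (FF : Filter F) p q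
    (f : U -> 'M[R]_(p, q)) (L : 'M[R]_(p, q)) :
  (f @ F --> L) <-> (forall i j, (fun u => f u i j) @ F --> L i j).
Proof.
split=> [fL i j|fL].
  exact: (cvg_comp _ _ fL (@coord_continuous _ _ _ i j L)).
apply/cvgrPdist_le => /= e e0.
have : \forall u \near F, forall ij : 'I_p * 'I_q,
    `|L ij.1 ij.2 - f u ij.1 ij.2| <= e.
  by apply: filter_forall => ij; have /cvgrPdist_le := fL ij.1 ij.2; exact.
apply: filterS => u fu; apply: mx_norm_le; first exact: ltW.
by move=> i j; rewrite !mxE; exact: fu (i, j).
Qed.

Lemma cvg_sum_ord (U : Type) (F : set_system U) (FF : Filter F) p
    (f : 'I_p -> U -> R) (l : 'I_p -> R) :
  (forall i, f i @ F --> l i) ->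
  (fun u => \sum_(i < p) f i u) @ F --> \sum_(i < p) l i.
Proof.
move=> fl; rewrite -[X in X @ F --> _]fct_sumE.
by elim/big_ind2 : _ => //; [exact: cvg_cst|move=> *; exact: cvgD].
Qed.

Lemma cvg_mulmx (U : Type) (F : set_system U) (FF : Filter F) p q s
    (f : U -> 'M[R]_(p, q)) (g : U -> 'M[R]_(q, s))
    (L : 'M[R]_(p, q)) (M : 'M[R]_(q, s)) :
  f @ F --> L -> g @ F --> M -> (fun u => f u *m g u) @ F --> L *m M.
Proof.
move=> /cvg_mxP fL /cvg_mxP gM; apply/cvg_mxP => i j; rewrite mxE.
under eq_fun do rewrite mxE.
by apply: cvg_sum_ord => k; apply: cvgM.
Qed.

Lemma cvg_trmx (U : Type) (F : set_system U) (FF : Filter F) p q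
    (f : U -> 'M[R]_(p, q)) (L : 'M[R]_(p, q)) :
  f @ F --> L -> (fun u => (f u)^T) @ F --> L^T.
Proof.
move=> /cvg_mxP fL; apply/cvg_mxP => i j; rewrite mxE.
by under eq_fun do rewrite mxE; exact: fL.
Qed.

Lemma within_continuous_norm (A : set R) p q (f : R -> 'M[R]_(p, q)) :
  {within A, continuous f} -> {within A, continuous (fun t => `|f t|)}.
Proof. by move=> cf x; exact: cvg_norm (cf x). Qed.

Lemma is_derive_entry p q (f : R -> 'M[R]_(p, q)) (t : R) D i j :
  is_derive t 1 f D -> is_derive t 1 (fun u => f u i j) (D i j).
Proof.
move=> [df fD]; apply: DeriveDef; first by have /derivable_mxP := df; exact.
by rewrite -fD derive_mx// mxE.
Qed.

Lemma is_derive_sum_ord p (h : 'I_p -> R -> R) (t : R) dh :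
  (forall i, is_derive t 1 (h i) (dh i)) ->
  is_derive t 1 (fun u => \sum_(i < p) h i u) (\sum_(i < p) dh i).
Proof. by move=> hd; rewrite -fct_sumE; exact: is_derive_sum. Qed.

Lemma is_derive_ext (f g : R -> R) (t d d' : R) :
  is_derive t 1 f d -> (forall u, f u = g u) -> d = d' -> is_derive t 1 g d'.
Proof. by move=> fd fg <-; have <- : f = g by exact/funext. Qed.

Lemma is_derive_expRM (k t : R) :
  is_derive t 1 (fun u => expR (k * u)) (k * expR (k * t)).
Proof.
apply: (@is_derive_ext (expR \o (k \*: id)) _ _ (expR (k * t) * (k *: 1))) => //.
by rewrite mulrC [k *: 1]mulr1.
Qed.

Lemma continuous_expRM (k : R) : continuous (fun u => expR (k * u) : R).
Proof.
move=> x; apply: (continuous_comp (g := expR)); last exact: continuous_expR.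
exact: mulrl_continuous.
Qed.

End MatrixFunctions.

(** * Gronwall inequalities *)

Section Gronwall.
Context {R : realType}.

(** The function [expR (- k * u) * f u - a * u] is nonincreasing. *)
Lemma gronwall_derive (T k a : R) (f f' : R -> R) :
  0 <= k -> 0 <= a -> 0 <= f 0 ->
  {within `[0, T], continuous f} ->
  (forall t : R, t \in `]0, T[ -> is_derive t 1 f (f' t)) ->
  (forall t : R, t \in `]0, T[ -> f' t <= k * f t + a) ->
  forall t : R, t \in `[0, T] -> f t <= (f 0 + a * T) * expR (k * T).
Proof.
move=> k0 a0 f0 cf df f'le t; rewrite in_itv/= => /andP[t0 tT].
pose g (u : R) : R := expR (- k * u) * f u - a * u.
have dg (u : R) : u \in `]0, T[ ->
    is_derive u 1 g (expR (- k * u) * f' u + f u * (- k * expR (- k * u)) - a).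
  move=> uT; have fu := df _ uT; have eu := is_derive_expRM (- k) u.
  apply: (@is_derive_ext _ ((fun u => expR (- k * u)) * f - a \*: id) g) => //.
  by rewrite [a *: 1]mulr1.
have g'le0 (u : R) : u \in `]0, T[ -> derive1 g u <= 0.
  move=> uT; rewrite derive1E; have [_ ->] := dg _ uT.
  have := f'le _ uT; rewrite -subr_ge0 => h.
  have e1 : expR (- k * u) <= 1.
    rewrite -expR0 ler_expR mulNr oppr_le0 mulr_ge0//.
    by move: uT; rewrite in_itv/= => /andP[/ltW].
  have := mulr_ge0 (expR_ge0 (- k * u)) h.
  by have := ler_wpM2r a0 e1; lra.
have cg : {within `[0, T], continuous g}.
  move=> x; apply: cvgB; last first.
    by apply: (continuous_subspaceT (f := *%R a)); exact: mulrl_continuous.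
  apply: cvgM; last exact: cf.
  exact: (continuous_subspaceT (@continuous_expRM _ (- k))).
have dg1 (u : R) : u \in `]0, T[ -> derivable g u 1 by move=> /dg [].
have T0 : 0 <= T by exact: le_trans tT.
have := ler0_derive1_le_cc dg1 g'le0 cg.
move=> /(_ t 0); rewrite !in_itv/= t0 tT lexx T0 => /(_ isT isT isT).
rewrite /g !mulr0 expR0 mul1r subr0 lerBlDr => h.
apply: (@le_trans _ _ ((f 0 + a * t) * expR (k * t))).
  by rewrite -ler_pdivrMr ?expR_gt0// -expRN -mulNr mulrC.
apply: ler_pM; rewrite ?expR_ge0 ?addr_ge0 ?mulr_ge0//.
  by rewrite lerD2l ler_wpM2l.
by rewrite ler_expR ler_wpM2l.
Qed.

(** Gronwall for matrices, through the squared Frobenius norm: unlike the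
    maximum of the entries it is differentiable. *)
Lemma gronwall_mx (T k : R) (p q : nat) : 0 <= k -> 0 <= T ->
  exists2 c, 0 <= c & forall (a : R) (D D' : R -> 'M[R]_(p, q)), 0 <= a ->
  {within `[0, T], continuous D} ->
  (forall t : R, t \in `]0, T[ -> is_derive t 1 D (D' t)) ->
  (forall t : R, t \in `]0, T[ -> `|D' t| <= k * `|D t| + a) ->
  forall t : R, t \in `[0, T] -> `|D t| <= c * (`|D 0| + a).
Proof.
move=> k0 T0; pose N : R := p%:R * q%:R.
have N0 : 0 <= N by rewrite mulr_ge0.
pose c2 := (N + N * T) * expR (N * (2 * k + 1) * T).
have c20 : 0 <= c2 by rewrite mulr_ge0 ?expR_ge0// addr_ge0// mulr_ge0.
exists (Num.sqrt c2) => [|a D D' a0 cD dD D'le t tT]; first exact: sqrtr_ge0.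
pose f (u : R) := \sum_(i < p) \sum_(j < q) D u i j ^+ 2.
have sum2 (E : 'I_p -> 'I_q -> R) b : (forall i j, E i j <= b) ->
    \sum_i \sum_j E i j <= N * b.
  move=> Eb; rewrite /N -mulrA -sumr_const_ord ler_sum// => i _.
  by rewrite -sumr_const_ord ler_sum.
have fge u i j : D u i j ^+ 2 <= f u.
  rewrite /f (bigD1 i)//= (bigD1 j)//= -addrA lerDl addr_ge0//.
    by apply: sumr_ge0 => ? _; exact: sqr_ge0.
  by do 2 (apply: sumr_ge0 => ? _); exact: sqr_ge0.
have f0 u : 0 <= f u by do 2 (apply: sumr_ge0 => ? _); exact: sqr_ge0.
have Df u : `|D u| ^+ 2 <= f u.
  rewrite -[leRHS]sqr_sqrtr// ler_sqr ?nnegrE ?sqrtr_ge0//.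
  apply: mx_norm_le => [|i j]; first exact: sqrtr_ge0.
  by rewrite -sqrtr_sqr ler_sqrt.
have sqrD u i j : D u i j ^+ 2 <= `|D u| ^+ 2.
  by rewrite -real_normK ?num_real// ler_sqr ?nnegrE// ler_mx_norm_entry.
pose f' (u : R) := \sum_(i < p) \sum_(j < q) 2 * (D u i j * D' u i j).
have df (u : R) : u \in `]0, T[ -> is_derive u 1 f (f' u).
  move=> /dD uD; do 2 apply: is_derive_sum_ord => ?.
  apply: is_derive_ext (is_deriveX 2 (is_derive_entry _ _ uD)) _ _ => //.
  by rewrite /= expr1; exact/esym/mulrA.
have f'le (u : R) : u \in `]0, T[ -> f' u <= (N * (2 * k + 1)) * f u + N * a ^+ 2.
  move=> uT; apply: (@le_trans _ _ (N * ((2 * k + 1) * `|D u| ^+ 2 + a ^+ 2))).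
    apply: sum2 => i j; apply: (@le_trans _ _ (2 * (`|D u| * (k * `|D u| + a)))).
      rewrite ler_wpM2l// (le_trans (ler_norm _))// normrM ler_pM//.
        exact: ler_mx_norm_entry.
      exact: le_trans (ler_mx_norm_entry _ _ _) (D'le _ uT).
    by have := sqr_ge0 (`|D u| - a); nra.
  rewrite mulrDr lerD2r -mulrA ler_wpM2l// ler_wpM2l ?Df//.
  by rewrite addr_ge0// mulr_ge0.
have cf : {within `[0, T], continuous f}.
  move=> x; apply: cvg_sum_ord => i; apply: cvg_sum_ord => j.
  by apply: cvgM; have /cvg_mxP := cD x; exact.
have kk0 : 0 <= N * (2 * k + 1) by rewrite mulr_ge0// addr_ge0// mulr_ge0.
have aa0 : 0 <= N * a ^+ 2 by rewrite mulr_ge0// sqr_ge0.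
have := gronwall_derive kk0 aa0 (f0 _) cf df f'le tT.
move=> /(le_trans (Df _)) h.
rewrite -(@ger0_norm _ (`|D 0| + a)) ?addr_ge0// -sqrtr_sqr -sqrtrM//.
rewrite -(normr_id (D t)) -sqrtr_sqr ler_sqrt; last first.
  exact: mulr_ge0 c20 (sqr_ge0 _).
apply: (le_trans h); rewrite /c2 [leRHS]mulrAC ler_wpM2r ?expR_ge0//.
have f0N : f 0 <= N * `|D 0| ^+ 2 by apply: sum2 => i j; exact: sqrD.
apply: (@le_trans _ _ (N * `|D 0| ^+ 2 + N * T * a ^+ 2)).
  by apply: lerD => //; rewrite mulrAC.
rewrite mulrDl; apply: lerD; apply: ler_wpM2l => //; rewrite ?mulr_ge0//.
  by rewrite ler_sqr ?nnegrE ?addr_ge0// lerDl.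
by rewrite ler_sqr ?nnegrE ?addr_ge0// lerDr.
Qed.

Notation mu := (@lebesgue_measure R).

(** The primitive of [u] satisfies the differential inequality. *)
Lemma gronwall_integral (T k a : R) (u : R -> R) : 0 < T ->
  0 <= k -> 0 <= a ->
  {within `[0, T], continuous u} ->
  (forall t : R, t \in `[0, T] -> u t <= a + k * \int[mu]_(s in `[0, t]) u s) ->
  forall t : R, t \in `[0, T] -> u t <= (1 + k * T * expR (k * T)) * a.
Proof.
move=> T0 k0 a0 cu ule t tT.
have iu : mu.-integrable `[0, T] (EFin \o u).
  by apply: continuous_compact_integrable => //; exact: segment_compact.
pose U (v : R) : R := \int[mu]_(s in `[0, v]) u s.
have U0 : U 0 = 0 by rewrite /U set_itv1 Rintegral_set1.
have cU : {within `[0, T], continuous U}.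
  exact: parameterized_integral_continuous (ltW T0) iu.
have dU (v : R) : v \in `]0, T[ -> is_derive v 1 U (u v).
  move=> vT; have := within_continuous_continuous T0 cu vT.
  move: vT; rewrite in_itv/= => /andP[v0 vT] cuv.
  have [dU1 dU2] := continuous_FTC1_closed vT iu v0 cuv.
  by apply: DeriveDef; [exact: dU1|rewrite -derive1E; exact: dU2].
have U00 : 0 <= U 0 by rewrite U0.
have Ule (v : R) : v \in `]0, T[ -> u v <= k * U v + a.
  move=> vT; rewrite addrC; apply: ule.
  by move: vT; rewrite !in_itv/= => /andP[/ltW-> /ltW->].
have := gronwall_derive k0 a0 U00 cU dU Ule tT.
rewrite U0 add0r => UT; apply: (le_trans (ule _ tT)).
rewrite mulrDl mul1r lerD2l.
apply: (@le_trans _ _ (k * (a * T * expR (k * T)))); first exact: ler_wpM2l.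
by rewrite le_eqVlt; apply/orP; left; apply/eqP; ring.
Qed.

(** Gronwall for curves known only through an integral equation, with a forcing
    term [g] that is merely integrable. *)
Lemma gronwall_caratheodory (T k a : R) n (e h : R -> 'cV[R]_n) (g : R -> R) :
  0 < T -> 0 <= k -> 0 <= a ->
  {within `[0, T], continuous e} ->
  (forall i, mu.-integrable `[0, T] (EFin \o (fun s => h s i 0))) ->
  mu.-integrable `[0, T] (EFin \o g) ->
  (forall s : R, s \in `[0, T] -> `|h s| <= k * `|e s| + g s) ->
  (forall s : R, s \in `[0, T] -> 0 <= g s) ->
  (forall t : R, t \in `[0, T] -> forall i,
     `|e t i 0| <= a + `|\int[mu]_(s in `[0, t]) h s i 0|) ->
  forall t : R, t \in `[0, T] ->
  `|e t| <= (1 + k * T * expR (k * T)) * (a + \int[mu]_(s in `[0, T]) g s).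
Proof.
move=> T0 k0 a0 ce ih ig hle g0 ele.
have cne := within_continuous_norm ce.
have ine : mu.-integrable `[0, T] (EFin \o (fun s => `|e s|)).
  by apply: continuous_compact_integrable => //; exact: segment_compact.
have G0 : 0 <= \int[mu]_(s in `[0, T]) g s.
  by apply: Rintegral_ge0 => s /= sT; apply: g0.
have sub (t : R) : t \in `[0, T] -> `[0, t]%classic `<=` `[0, T]%classic.
  by rewrite in_itv/= => /andP[_ tT]; apply: subset_itvl; rewrite bnd_simp.
have int_sub (f : R -> R) (t : R) : t \in `[0, T] -> mu.-integrable `[0, T] (EFin \o f) ->
    mu.-integrable `[0, t] (EFin \o f).
  by move=> tT; apply: integrableS => //; exact: sub.
have Gt (t : R) : t \in `[0, T] ->
    \int[mu]_(s in `[0, t]) g s <= \int[mu]_(s in `[0, T]) g s.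
  move=> tT.
  have := tT; rewrite in_itv/= => /andP[t0 tT'].
  have := @Rintegral_itvB _ g (BLeft 0) (BRight T) t ig.
  rewrite !bnd_simp => /(_ t0 tT') /eqP; rewrite subr_eq => /eqP ->.
  rewrite lerDr; apply: Rintegral_ge0 => s /=; rewrite in_itv/= => /andP[ts sT].
  by apply: g0; rewrite in_itv/= sT (le_trans t0 (ltW ts)).
apply: gronwall_integral => //; first exact: addr_ge0.
move=> t tT.
have I0 : 0 <= \int[mu]_(s in `[0, t]) `|e s| by apply: Rintegral_ge0.
apply: mx_norm_le => [|i j]; first by rewrite !addr_ge0// mulr_ge0.
rewrite ord1; apply: (le_trans (ele _ tT i)); rewrite -addrA lerD2l.
apply: le_trans (le_normr_Rintegral _ (int_sub _ _ tT (ih i))) _ => //.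
rewrite -RintegralZl//; last exact: int_sub.
rewrite addrC.
have ike : mu.-integrable `[0, t] (EFin \o (fun s => k * `|e s|)).
  rewrite (_ : _ \o _ = (fun s => k%:E * (`|e s|)%:E)%E)//.
  by apply: integrableZl => //; exact: (int_sub (fun s => `|e s|)).
apply: (@le_trans _ _ (\int[mu]_(s in `[0, t]) (k * `|e s| + g s))).
  apply: le_Rintegral => //.
  - exact/integrable_norm/int_sub.
  - rewrite (_ : _ \o _ = (EFin \o (fun s => k * `|e s|)) \+ (EFin \o g))//.
    by apply: integrableD => //; exact: int_sub.
  - move=> s /= st; apply: le_trans (ler_mx_norm_entry _ _ _) _.
    by apply: hle; exact: (sub _ tT).
rewrite RintegralD//; last exact: int_sub.
by rewrite lerD2l; exact: Gt.
Qed.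

End Gronwall.

(** * Positivity by barriers *)

Section Barrier.
Context {R : realType}.

Definition qf n (M : 'M[R]_n) (z : 'cV[R]_n) : R := dot z (M *m z).

Lemma qf_wide n (M : 'M[R]_n) z : qf M z = (z^T *m M *m z) 0 0.
Proof. by rewrite /qf /dot mulmxA. Qed.

Lemma qfE n (M : 'M[R]_n) z : qf M z = \sum_i \sum_j z i 0 * (M i j * z j 0).
Proof.
by rewrite /qf dotE; apply: eq_bigr => i _; rewrite mxE mulr_sumr.
Qed.

Lemma qfD n (M N : 'M[R]_n) z : qf (M + N) z = qf M z + qf N z.
Proof. by rewrite /qf mulmxDl dotDr. Qed.

Lemma qfN n (M : 'M[R]_n) z : qf (- M) z = - qf M z.
Proof. by rewrite /qf mulNmx dotNr. Qed.

Lemma qf_scalar n a (z : 'cV[R]_n) : qf a%:M z = a * dot z z.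
Proof. by rewrite /qf mul_scalar_mx dotZr. Qed.

Lemma qfZ n (M : 'M[R]_n) a z : qf M (a *: z) = a ^+ 2 * qf M z.
Proof. by rewrite /qf -scalemxAr dotZl dotZr mulrA. Qed.

Lemma qfDr n (M : 'M[R]_n) w z : M^T = M ->
  qf M (w + z) = qf M w + 2 * dot w (M *m z) + qf M z.
Proof.
move=> sM; rewrite /qf mulmxDr !dotDr !dotDl.
by rewrite [dot z (M *m w)]dot_trmx sM [dot (M *m z) w]dotC; ring.
Qed.

(** If [M *m z] were nonzero, moving slightly from [z] against it would make the
    form negative. *)
Lemma qf_eq0_ker n (M : 'M[R]_n) z : M^T = M ->
  (forall w, 0 <= qf M w) -> qf M z = 0 -> M *m z = 0.
Proof.
move=> sM M0 z0; apply/eqP; rewrite -dot_eq0; apply/eqP.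
set d := dot _ _; set q := qf M (M *m z).
have q0 : 0 <= q := M0 _.
have d0 : 0 <= d := dot_ge0 _.
have h s : 0 <= s ^+ 2 * q + 2 * s * d.
  have := M0 (s *: (M *m z) + z).
  by rewrite qfDr// qfZ dotZl z0 addr0 mulrA.
apply/eqP; rewrite eq_le d0 andbT leNgt; apply/negP => dgt.
(* Adding [1] to [q] avoids a case distinction on [q = 0]. *)
have q1 : 0 < q + 1 by rewrite ltr_wpDl.
have := h (- (d / (q + 1))); set e := d / (q + 1).
have ed : d = e * (q + 1) by rewrite divfK// gt_eqF.
have e0 : 0 < e by rewrite divr_gt0.
by rewrite ed; nra.
Qed.

Lemma within_continuous_qf (A : set R) n (H : R -> 'M[R]_n) z :
  {within A, continuous H} -> {within A, continuous (fun t => qf (H t) z)}.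
Proof.
have -> : (fun t => qf (H t) z) = (fun t => (z^T *m H t *m z) 0 0).
  by apply/funext => t; rewrite qf_wide.
move=> cH x.
have /cvg_mxP/(_ 0 0) :
    (fun t : subspace A => z^T *m H t *m z) @ x --> z^T *m H x *m z.
  apply: cvg_mulmx; last exact: cvg_cst.
  by apply: cvg_mulmx; [exact: cvg_cst|exact: cH].
exact.
Qed.

Lemma cvg_dot (U : Type) (F : set_system U) (FF : Filter F) n
    (f g : U -> 'cV[R]_n) (L M : 'cV[R]_n) :
  f @ F --> L -> g @ F --> M -> (fun u => dot (f u) (g u)) @ F --> dot L M.
Proof.
move=> /cvg_trmx fL gM.
by have /cvg_mxP/(_ 0 0) := cvg_mulmx FF fL gM; exact.
Qed.

Lemma is_derive_qf n (H : R -> 'M[R]_n) D z (t : R) :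
  is_derive t 1 H D -> is_derive t 1 (fun u => qf (H u) z) (qf D z).
Proof.
move=> dH.
have d2 : is_derive t 1
    (fun u => \sum_i \sum_j z i 0 * z j 0 * H u i j)
    (\sum_i \sum_j z i 0 * z j 0 * D i j).
  do 2 apply: is_derive_sum_ord => ?.
  by apply: is_deriveZ; exact: is_derive_entry.
apply: is_derive_ext d2 _ _ => [u|]; rewrite qfE.
  by do 2 (apply: eq_bigr => ? _); rewrite mulrAC mulrA.
by do 2 (apply: eq_bigr => ? _); rewrite mulrAC mulrA.
Qed.

(** Intermediate values: a negative end value would force [f] to take half of
    that value earlier. *)
Lemma ge0_at_right_end (f : R -> R) (s : R) : 0 < s ->
  {within `[0, s], continuous f} -> 0 < f 0 ->
  (forall t, 0 <= t < s -> 0 <= f t) -> 0 <= f s.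
Proof.
move=> s0 cf f0 fge; rewrite leNgt; apply/negP => fs.
have [|c] := @IVT _ f 0 s (f s / 2) (ltW s0) cf.
  by rewrite ge_min le_max; apply/andP; split; apply/orP; [right|left]; lra.
rewrite in_itv/= => /andP[c0 cs] fc.
have {}cs : c < s.
  by rewrite lt_neqAle cs andbT; apply/eqP => cs'; move: fc; rewrite cs'; lra.
by have := fge c; rewrite c0 cs => /(_ isT); rewrite fc; lra.
Qed.

Lemma derive_le0_of_left_ge (f : R -> R) (t d : R) : 0 < t -> is_derive t 1 f d ->
  (forall s, 0 <= s < t -> 0 <= f s) -> f t = 0 -> d <= 0.
Proof.
move=> t0 [df <-] fge ft; rewrite leNgt; apply/negP => d0.
have := cvgr_gt _ df _ d0.
move=> -[r /= r0 hr].
pose e := Num.min (r / 2) t.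
have e0 : 0 < e by rewrite lt_min t0 divr_gt0.
have := hr (- e); rewrite /ball_/= sub0r opprK gtr0_norm//.
have er : e < r by rewrite gt_min; apply/orP; left; lra.
move=> /(_ er); rewrite oppr_eq0 gt_eqF// => /(_ isT).
rewrite [_ *: 1]mulr1 ft subr0 /GRing.scale/= invrN mulNr oppr_gt0.
rewrite pmulr_rlt0 ?invr_gt0// => h.
have /fge : 0 <= - e + t < t.
  by rewrite addrC subr_ge0 ltrBlDr ltrDl e0 andbT ge_min lexx orbT.
by rewrite leNgt h.
Qed.

Lemma clamp_continuous (T : R) (U : topologicalType) (f : R -> U) : 0 <= T ->
  {within `[0, T], continuous f} ->
  continuous (fun t => f (Num.max 0 (Num.min t T))).
Proof.
move=> T0 /subspace_continuousP cf t.
pose c (u : R) : R := Num.max 0 (Num.min u T).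
have cT u : `[0, T]%classic (c u).
  by rewrite /= in_itv/= /c le_max lexx/= ge_max T0 ge_min lexx orbT.
have cc : {for t, continuous c}.
  apply: (@continuous_max R _ (fun=> 0) (fun u => Num.min u T)).
    exact: cst_continuous.
  apply: (@continuous_min R _ id (fun=> T)); first exact: cvg_id.
  exact: cst_continuous.
apply: (@cvg_trans _ (f @ within `[0, T] (nbhs (c t)))); last exact: cf.
move=> A wA; have ccA : \forall u \near t, `[0, T]%classic (c u) -> A (f (c u)).
  exact: cc _ wA.
by apply: filterS ccA => u fu; exact: fu (cT u).
Qed.

(** At the first time [ts] where the curve ceases to be definite, compactness of
    the unit sphere yields a unit vector [zs] with [qf (H ts) zs = 0]. It lies in
    the kernel of [H ts], so the hypothesis makes the derivative of
    [qf (H t) zs] at [ts] positive; but this function is positive before [ts] and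
    vanishes at [ts]. *)
Lemma psd_barrier n (T : R) (H H' : R -> 'M[R]_n) : 0 < T ->
  {within `[0, T], continuous H} ->
  (forall t : R, t \in `[0, T] -> (H t)^T = H t) ->
  (forall z : 'cV_n, z != 0 -> 0 < qf (H 0) z) ->
  (forall t : R, t \in `]0, T[ -> is_derive t 1 H (H' t)) ->
  (forall t : R, t \in `]0, T[ ->
     forall z : 'cV_n, z != 0 -> H t *m z = 0 -> 0 < qf (H' t) z) ->
  forall t : R, t \in `[0, T] -> forall z, 0 <= qf (H t) z.
Proof.
move=> T0 cH symH H0 dH bar.
have qf0 M : qf M (0 : 'cV[R]_n) = 0 by rewrite /qf /dot !mulmx0 mxE.
have cHs (s : R) z : s <= T ->
    {within `[0, s], continuous (fun t : R => qf (H t) z)}.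
  move=> sT; apply: within_continuous_qf.
  by apply: continuous_subspaceW cH; apply: subset_itvl; rewrite bnd_simp.
suff main (t : R) (z : 'cV[R]_n) : 0 <= t < T -> z != 0 -> 0 < qf (H t) z.
  move=> t; rewrite in_itv/= => /andP[t0 tT] z.
  have [->|z0] := eqVneq z 0; first by rewrite qf0.
  move: tT; rewrite le_eqVlt => /predU1P[->|tT]; last first.
    by apply/ltW/main => //; rewrite t0 tT.
  apply: (@ge0_at_right_end (fun t => qf (H t) z)) => //.
  - exact: cHs.
  - exact: H0.
  - by move=> s sT; apply/ltW/main.
move=> /andP[t0 tT] z0; rewrite ltNge; apply/negP => Htz.
(* A globally continuous extension of [H], so that the set [K] below is closed
   in the full product space. *)
pose Hc (u : R) := H (Num.max 0 (Num.min u T)).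
have HcE (u : R) : 0 <= u <= T -> Hc u = H u.
  by move=> /andP[u0 uT]; rewrite /Hc (min_idPl uT) (max_idPr u0).
have cHc : continuous Hc by apply: clamp_continuous => //; exact: ltW.
pose S := [set x : 'rV[R]_n | dot x^T x^T = 1].
have ctr : continuous (fun x : 'rV[R]_n => x^T).
  by move=> x; apply: (@cvg_trmx R _ (nbhs x) _ 1 n id x) => A.
have cS : compact S.
  apply: bounded_closed_compact.
    exists 1; split => // r r1 x /= x1; rewrite -mx_norm_tr.
    rewrite (le_trans _ (ltW r1))// -(@ler_pXn2r _ 2)// ?nnegrE// expr1n -x1.
    exact: mx_norm_sqr_le_dot.
  apply: (@preimage_closed _ _ (fun x : 'rV[R]_n => dot x^T x^T) [set 1]).
    by move=> x _; exact: (cvg_dot (nbhs_filter x) (ctr x) (ctr x)).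
  exact: closed_eq.
pose K := [set p : R * 'rV[R]_n |
  (`[0, t]%classic `*` S) p /\ qf (Hc p.1) p.2^T <= 0].
have cK : compact K.
  apply: (@subclosed_compact _ _ (`[0, t]%classic `*` S)); last by move=> p [].
    apply: closedI.
      apply: compact_closed; first exact: norm_hausdorff.
      by apply: compact_setX => //; exact: segment_compact.
    apply: (@preimage_closed _ _ (fun p : R * 'rV[R]_n => qf (Hc p.1) p.2^T)
      [set x | x <= 0]); last exact: closed_le.
    move=> p _.
    have c2 : (fun q : R * 'rV[R]_n => q.2^T) @ p --> p.2^T.
      by apply: continuous_comp; [exact: cvg_snd|exact: ctr].
    have c1 : (fun q : R * 'rV[R]_n => Hc q.1) @ p --> Hc p.1.
      by apply: continuous_comp; [exact: cvg_fst|exact: cHc].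
    by apply: cvg_dot => //; exact: cvg_mulmx.
  by apply: compact_setX => //; exact: segment_compact.
pose l (w : 'cV[R]_n) := (Num.sqrt (dot w w))^-1.
have unit_l w : w != 0 -> dot (l w *: w) (l w *: w) = 1.
  move=> w0; have d0 := dot_gt0 w0.
  rewrite dotZl dotZr mulrA -invfM -expr2 sqr_sqrtr ?ltW// mulVf//.
  by rewrite gt_eqF.
have K0 : K !=set0.
  exists (t, (l z *: z)^T); split => /=.
    by split => /=; [rewrite in_itv/= t0 lexx|rewrite /S/= trmxK; exact: unit_l].
  by rewrite trmxK HcE ?t0 ?(ltW tT)// qfZ mulr_ge0_le0// sqr_ge0.
have [|[ts zs] /set_mem[/= [tst zs1] Hts] tsmin] :=
    @compact_EVT_min _ _ (fun p : R * 'rV[R]_n => p.1) _ K0 cK.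
  by apply: continuous_subspaceT => p; exact: cvg_fst.
move: tst; rewrite /= in_itv/= => /andP[ts0 tst].
have tsT : ts < T := le_lt_trans tst tT.
move: Hts; rewrite HcE ?ts0 ?(ltW tsT)// => Hts.
have zs0 : zs^T != 0.
  by apply/eqP => zs0; move: zs1; rewrite /S/= zs0 /dot mulmx0 mxE => /eqP;
    rewrite eq_sym oner_eq0.
have pos (s : R) w : 0 <= s < ts -> w != 0 -> 0 < qf (H s) w.
  move=> /andP[s0 sts] w0; rewrite ltNge; apply/negP => Hsw.
  have /tsmin/= : (s, (l w *: w)^T) \in K.
    apply/mem_set; split => /=.
      split => /=; last by rewrite /S/= trmxK unit_l.
      by rewrite in_itv/= s0 (ltW (lt_le_trans sts tst)).
    rewrite trmxK HcE ?s0 ?(ltW (lt_trans sts tsT))//.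
    by rewrite qfZ mulr_ge0_le0// sqr_ge0.
  by rewrite leNgt sts.
have {}ts0 : 0 < ts.
  rewrite lt_neqAle ts0 andbT; apply/eqP => ts0'.
  by move: Hts; rewrite -ts0' leNgt H0.
have psd w : 0 <= qf (H ts) w.
  have [->|w0] := eqVneq w 0; first by rewrite qf0.
  apply: (@ge0_at_right_end (fun t => qf (H t) w)) => //.
  - exact/cHs/ltW.
  - exact: H0.
  - by move=> s sT; apply/ltW/pos.
have qz : qf (H ts) zs^T = 0 by apply/eqP; rewrite eq_le Hts psd.
have tsin : ts \in `]0, T[ by rewrite in_itv/= ts0.
have ker : H ts *m zs^T = 0.
  by apply: qf_eq0_ker => //; apply: symH; rewrite in_itv/= !ltW.
have := bar _ tsin _ zs0 ker; rewrite ltNge => /negP; apply.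
apply: (derive_le0_of_left_ge ts0 (is_derive_qf _ (dH _ tsin))) => //.
by move=> s sts; apply/ltW/pos.
Qed.

End Barrier.

(** * Estimates for quadratic forms *)

Section QuadraticForms.
Context {R : realType}.

Lemma qf_abs_le n (M : 'M[R]_n) z : `|qf M z| <= n%:R * `|M| * dot z z.
Proof.
rewrite qfE; apply: (le_trans (ler_norm_sum _ _ _)).
apply: (@le_trans _ _
  (\sum_(i < n) \sum_(j < n) `|M| * ((z i 0 * z i 0 + z j 0 * z j 0) / 2))).
  apply: ler_sum => i _; apply: (le_trans (ler_norm_sum _ _ _)).
  apply: ler_sum => j _; rewrite mulrCA normrM ler_pM ?ler_mx_norm_entry//.
  rewrite ler_norml; have := sqr_ge0 (z i 0 - z j 0).
  have := sqr_ge0 (z i 0 + z j 0).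
  by rewrite !expr2 => *; apply/andP; split; lra.
under eq_bigr => i _ do rewrite -mulr_sumr -mulr_suml big_split/= sumr_const_ord -dotE.
rewrite -mulr_sumr -mulr_suml big_split/= sumr_const_ord -mulr_sumr -dotE.
by rewrite le_eqVlt; apply/orP; left; apply/eqP; field.
Qed.

Lemma qf_ker_unitmx n (M : 'M[R]_n) : M^T = M ->
  (forall z, z != 0 -> 0 < qf M z) -> M \in unitmx.
Proof.
move=> sM M0; rewrite -row_free_unit; apply: inj_row_free => v vM.
apply/eqP/negPn/negP => v0.
have : 0 < qf M v^T by apply: M0; rewrite trmx_eq0.
by rewrite /qf -{1}sM -trmx_mul vM trmx0 /dot mulmx0 mxE ltxx.
Qed.

Lemma spd_qf n (M : 'M[R]_n) z : spd M -> z != 0 -> 0 < qf M z.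
Proof. by rewrite qf_wide => -[_ +]; exact. Qed.

Lemma spd_unitmx n (M : 'M[R]_n) : spd M -> M \in unitmx.
Proof.
by move=> sM; apply: qf_ker_unitmx => [|z]; [case: sM|exact: spd_qf].
Qed.

Lemma spd_qf_ge0 n (M : 'M[R]_n) z : spd M -> 0 <= qf M z.
Proof.
move=> sM; have [->|z0] := eqVneq z 0; last exact/ltW/spd_qf.
by rewrite /qf /dot !mulmx0 mxE.
Qed.

Lemma qf_conj p q (M : 'M[R]_q) (L : 'M[R]_(p, q)) z :
  qf (L *m M *m L^T) z = qf M (L^T *m z).
Proof. by rewrite /qf -!mulmxA dot_trmx. Qed.

Lemma qf_invmx n (M : 'M[R]_n) z : M \in unitmx ->
  qf (invmx M) z = qf M (invmx M *m z).
Proof. by move=> uM; rewrite /qf mulKVmx// dotC. Qed.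

Lemma spd_invmx_qf_ge0 n (M : 'M[R]_n) z : spd M -> 0 <= qf (invmx M) z.
Proof.
by move=> sM; rewrite qf_invmx ?spd_unitmx//; exact: spd_qf_ge0.
Qed.

(** Nonnegativity of [qf M] at [(k + 1) *: z - invmx M *m z], where
    [k := n%:R * K] bounds the form of the inverse. *)
Lemma spd_qf_lower n (M : 'M[R]_n) K z : spd M -> `|invmx M| <= K ->
  dot z z <= (n%:R * K + 1) * qf M z.
Proof.
move=> sM MK; have uM := spd_unitmx sM; have [symM _] := sM.
have K0 : 0 <= K by exact: le_trans MK.
have nK0 : 0 <= n%:R * K by rewrite mulr_ge0.
set k := n%:R * K in nK0 *.
pose v := invmx M *m z.
have qv : qf M (- v) <= k * dot z z.
  rewrite -scaleN1r qfZ sqrrN expr1n mul1r -qf_invmx//.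
  apply: (le_trans (ler_norm _)); apply: (le_trans (qf_abs_le _ _)).
  by rewrite ler_wpM2r ?dot_ge0// ler_wpM2l.
have := spd_qf_ge0 ((k + 1) *: z - v) sM.
rewrite qfDr// qfZ mulmxN mulKVmx// dotNr dotZl.
move: (dot_ge0 z) qv; set d := dot z z; set q := qf M z => d0 qv h.
have k1 : 0 < k + 1 by lra.
by rewrite -(ler_pM2l k1); nra.
Qed.

(** The entries are recovered from the values of the form at [e i + e j] and
    [e i - e j]. *)
Lemma mx_norm_le_qf n (M : 'M[R]_n) b : M^T = M -> 0 <= b ->
  (forall z, 0 <= qf M z) -> (forall z, qf M z <= b * dot z z) -> `|M| <= b.
Proof.
move=> sM b0 M0 Mb; apply: mx_norm_le => // i j.
pose e k : 'cV[R]_n := delta_mx k 0.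
have eM k l : dot (e k) (M *m e l) = M k l.
  rewrite -colE dotE (bigD1 k)//= !mxE !eqxx mul1r big1 ?addr0// => h hk.
  by rewrite !mxE (negbTE hk) mul0r.
have ee k : dot (e k) (e k) = 1.
  rewrite dotE (bigD1 k)//= !mxE !eqxx mul1r big1 ?addr0// => h hk.
  by rewrite !mxE (negbTE hk) mul0r.
have Mi k : qf M (e k) <= b by rewrite (le_trans (Mb _))// ee mulr1.
have Qe k : qf M (- e k) = qf M (e k).
  by rewrite -scaleN1r qfZ sqrrN expr1n mul1r.
have hp := M0 (e i + e j); have hm := M0 (e i - e j).
move: hp hm; rewrite !qfDr// Qe mulmxN dotNr eM => hp hm.
have Mi1 := Mi i; have Mj1 := Mi j.
by rewrite ler_norml; apply/andP; split; lra.
Qed.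

(** With [v := invmx M *m z] the left-hand side is [dot v z]; the estimate is the
    nonnegativity of the squared length of [dlt *: v - z]. *)
Lemma qf_invmx_le n (M : 'M[R]_n) dlt z : M^T = M -> 0 < dlt ->
  (forall w, dlt * dot w w <= qf M w) -> qf (invmx M) z <= dot z z / dlt.
Proof.
move=> sM d0 Md.
have uM : M \in unitmx.
  apply: qf_ker_unitmx => // w w0; apply: lt_le_trans (Md _).
  by rewrite mulr_gt0// dot_gt0.
rewrite ler_pdivlMr// mulrC; set v := invmx M *m z.
have vz : qf (invmx M) z = dot v z by rewrite /qf dotC.
have Mv : dlt * dot v v <= dot v z.
  by rewrite -vz qf_invmx//; exact: Md.
have := dot_ge0 (dlt *: v - z).
rewrite dotDl !dotDr !dotNl !dotNr !dotZl !dotZr [dot z v]dotC vz => h.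
by have := ler_wpM2l (ltW d0) Mv; nra.
Qed.

End QuadraticForms.

Section MatrixDerivatives.
Context {R : realType}.

Lemma is_derive_mx p q (f : R -> 'M[R]_(p, q)) (t : R) (D : 'M[R]_(p, q)) :
  (forall i j, is_derive t 1 (fun u => f u i j) (D i j)) ->
  is_derive t 1 f D.
Proof.
move=> fD; have df : derivable f t 1.
  by apply/derivable_mxP => i j; have [] := fD i j.
apply: DeriveDef => //; apply/matrixP => i j.
by rewrite derive_mx// mxE; have [_] := fD i j.
Qed.

Lemma is_derive_trmx p q (f : R -> 'M[R]_(p, q)) (t : R) (D : 'M[R]_(p, q)) :
  is_derive t 1 f D -> is_derive t 1 (fun u => (f u)^T) D^T.
Proof.
move=> fD; apply: is_derive_mx => i j; rewrite mxE.
by apply: is_derive_ext (is_derive_entry j i fD) _ _ => // u; rewrite mxE.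
Qed.

Lemma is_derive_scalar_mx n (f : R -> R) (t : R) d :
  is_derive t 1 f d -> is_derive t 1 (fun u => (f u)%:M : 'M[R]_n) d%:M.
Proof.
move=> fd; apply: is_derive_mx => i j; rewrite mxE.
case: eqVneq => [->|ij].
  by apply: is_derive_ext fd _ _ => // u; rewrite mxE eqxx.
apply: is_derive_ext (is_derive_cst 0 _ _) _ _ => // u.
by rewrite mxE (negbTE ij).
Qed.

Lemma within_continuous_scalar_mx n (A : set R) (f : R -> R) :
  {within A, continuous f} ->
  {within A, continuous (fun u => (f u)%:M : 'M[R]_n)}.
Proof.
move=> cf x; apply/cvg_mxP => i j; under eq_fun do rewrite mxE; rewrite mxE.
by case: eqP => _; [exact: cf|exact: cvg_cst].
Qed.

Lemma within_continuous_trmx (A : set R) p q (f : R -> 'M[R]_(p, q)) :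
  {within A, continuous f} -> {within A, continuous (fun u => (f u)^T)}.
Proof. by move=> cf x; apply: cvg_trmx; exact: cf. Qed.

Lemma within_continuous_mulmx (A : set R) p q s (f : R -> 'M[R]_(p, q))
    (g : R -> 'M[R]_(q, s)) :
  {within A, continuous f} -> {within A, continuous g} ->
  {within A, continuous (fun u => f u *m g u)}.
Proof. by move=> cf cg x; apply: cvg_mulmx; [exact: cf|exact: cg]. Qed.

Lemma within_bounded_mx (T : R) p q (f : R -> 'M[R]_(p, q)) : 0 <= T ->
  {within `[0, T], continuous f} ->
  exists2 b, 0 <= b & forall t : R, t \in `[0, T] -> `|f t| <= b.
Proof.
move=> T0 /within_continuous_norm cf.
by have [c _ cmax] := EVT_max T0 cf; exists `|f c|.
Qed.

End MatrixDerivatives.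

(** * Riccati equation *)

Section Riccati.
Context {R : realType} (T : R) (T0 : 0 < T) (n m r : nat).
Context (B : 'M[R]_(n, m)) (C : 'M[R]_(r, n)).

Definition riccati_field (A : 'M[R]_n) (W : 'M[R]_m) (Q : 'M[R]_r) (P : 'M[R]_n) :=
  A *m P + P *m A^T - P *m C^T *m invmx Q *m C *m P + B *m W *m B^T.

(** The uniform hypothesis on the data in the form used by the estimates, for the
    maximum norm. *)
Definition tame (K : R) (S : quad R n m r) : Prop :=
  let: (A, G, W, Q) := S in
  [/\ [/\ spd G, spd W & spd Q], `|A| <= K,
      `|G| <= K /\ `|invmx G| <= K, `|W| <= K & `|invmx Q| <= K].

Lemma tame_of_bounded K (S : quad R n m r) :
  admissible S -> bounded_quad K S -> tame (`|K| + 1) S.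
Proof.
move: S => [[[A G] W] Q] /= spds [AK [GK GVK] [WK _] [_ QVK]].
have le p q (M : 'M[R]_(p, q)) : opnorm2 M <= K -> `|M| <= `|K| + 1.
  move=> MK; apply: le_trans (mx_norm_le_opnorm2 M) (le_trans MK _).
  by rewrite (le_trans (ler_norm K))// lerDl.
by split=> //; [exact: le|split; exact: le|exact: le|exact: le].
Qed.

Lemma riccati_field_tr A W Q P : W^T = W -> Q^T = Q ->
  (riccati_field A W Q P)^T = riccati_field A W Q P^T.
Proof.
move=> sW sQ; rewrite /riccati_field !linearD linearN /=.
rewrite !trmx_mul !trmxK trmx_inv sW sQ !mulmxA; congr (_ - _ + _).
by rewrite addrC.
Qed.

(** The transpose solves the same equation, so symmetry is uniqueness. *)
Lemma riccati_sym A G W Q Pi : G^T = G -> W^T = W -> Q^T = Q ->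
  riccati_solution T B C (A, G, W, Q) Pi ->
  forall t : R, t \in `[0, T] -> (Pi t)^T = Pi t.
Proof.
move=> sG sW sQ [cPi Pi0 dPi] t tT.
have [b b0 Pib] := within_bounded_mx (ltW T0) cPi.
pose M := C^T *m invmx Q *m C.
pose k := n%:R * `|A| + n%:R * `|A| + n%:R * (n%:R * `|M|) * b
  + n%:R * (n%:R * b * `|M|).
have k0 : 0 <= k by rewrite !addr_ge0 ?mulr_ge0.
have [c c0 gron] := gronwall_mx n n k0 (ltW T0).
pose D (u : R) := Pi u - (Pi u)^T.
pose D' (u : R) := riccati_field A W Q (Pi u) - riccati_field A W Q (Pi u)^T.
have cD : {within `[0, T], continuous D}.
  exact: within_continuousB cPi (within_continuous_trmx cPi).
have dD (u : R) : u \in `]0, T[ -> is_derive u 1 D (D' u).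
  move=> uT; rewrite /D' -riccati_field_tr//.
  by apply: is_deriveB; [exact: dPi|apply/is_derive_trmx/dPi].
have D'le (u : R) : u \in `]0, T[ -> `|D' u| <= k * `|D u| + 0.
  move=> uT; have {}Pib : `|Pi u| <= b.
    by apply: Pib; move: uT; rewrite !in_itv/= => /andP[/ltW-> /ltW->].
  have -> : D' u = A *m D u + D u *m A^T
      - (D u *m M *m Pi u + (Pi u)^T *m M *m D u).
    rewrite /D' /D /riccati_field /M.
    move: (Pi u) ((Pi u)^T) => P P'.
    rewrite !mulmxBr !mulmxBl !mulmxA.
    by apply/matrixP => i j; rewrite !mxE; ring.
  rewrite addr0 /k !mulrDl -[leRHS]addrA; apply: (le_trans (ler_normB _ _)).
  apply: (le_trans (lerD (ler_normD _ _) (ler_normD _ _))).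
  apply: lerD; apply: lerD.
  - exact: mx_normM_le.
  - by rewrite mulrAC -(mx_norm_tr A); exact: mx_normM_le.
  - rewrite (_ : _ * `|D u| = n%:R * (n%:R * `|D u| * `|M|) * b); last by ring.
    by do 2?apply: mx_normM_le2.
  - rewrite (_ : _ * `|D u| = n%:R * (n%:R * b * `|M|) * `|D u|); last by ring.
    by do 2?apply: mx_normM_le2; rewrite ?mx_norm_tr.
have := gron 0 D D' (lexx _) cD dD D'le t tT.
rewrite {2}/D Pi0 sG subrr normr0 addr0 mulr0 normr_le0 subr_eq0.
by move=> /eqP <-.
Qed.

(** On eigenvectors of [P] the matrix equation becomes a scalar one. *)
Lemma qf_riccati_field A W Q P mu z : P^T = P -> P *m z = mu *: z ->
  qf (riccati_field A W Q P) z =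
  2 * mu * qf A z - mu ^+ 2 * qf (C^T *m invmx Q *m C) z + qf (B *m W *m B^T) z.
Proof.
move=> sP Pz; rewrite /riccati_field !qfD qfN; congr (_ - _ + _).
- rewrite /qf -!mulmxA Pz -scalemxAr dotZr [dot z (P *m _)]dot_trmx sP Pz.
  by rewrite dotZl [dot z (A^T *m z)]dot_trmx trmxK [dot (A *m z) z]dotC; ring.
- rewrite /qf -!mulmxA Pz dot_trmx sP Pz -!scalemxAr dotZl dotZr.
  by rewrite expr2 mulrA !mulmxA.
Qed.

(** Two-sided bounds by exponential barriers. Below, the quadratic term is of
    second order in the small barrier value and the forcing term has a
    favourable sign; above, the quadratic term has the favourable sign and the
    forcing term is dominated since the barrier value is at least [1]. The rate
    [L] absorbs the remaining terms in both cases. *)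
Lemma riccati_qf_bounds K : 0 <= K -> exists dl b : R,
  [/\ 0 < dl, 0 < b & forall A G W Q Pi, tame K (A, G, W, Q) ->
    riccati_solution T B C (A, G, W, Q) Pi ->
    forall t : R, t \in `[0, T] ->
    [/\ (Pi t)^T = Pi t,
        forall z, dl * dot z z <= qf (Pi t) z &
        forall z, qf (Pi t) z <= b * dot z z]].
Proof.
move=> K0.
pose nK : R := n%:R * K; have nK0 : 0 <= nK by rewrite mulr_ge0.
pose mC : R := n%:R * (r%:R * (r%:R * `|C| * K) * `|C|).
have mC0 : 0 <= mC by rewrite !mulr_ge0.
pose mB : R := n%:R * (m%:R * (m%:R * `|B| * K) * `|B|).
have mB0 : 0 <= mB by rewrite !mulr_ge0.
pose L := 2 * nK + mC + mB + 1; have L0 : 0 < L by rewrite /L; lra.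
pose d0 := (2 * (nK + 1))^-1; pose b0 := nK + 1.
have d00 : 0 < d0 by rewrite invr_gt0; lra.
have d01 : d0 <= 1 by rewrite invf_le1; lra.
have b01 : 1 <= b0 by rewrite /b0; lra.
exists (d0 * expR (- L * T)), (b0 * expR (L * T)).
split=> [||A G W Q Pi [[sG sW sQ] AK [GK GVK] WK QK] solPi].
- by rewrite mulr_gt0// expR_gt0.
- by rewrite mulr_gt0// ?expR_gt0// (lt_le_trans ltr01).
have [symG _] := sG; have [symW _] := sW; have [symQ _] := sQ.
have sPi := riccati_sym symG symW symQ solPi.
have [cPi Pi0 dPi] := solPi.
have qA z : `|qf A z| <= nK * dot z z.
  by apply: (le_trans (qf_abs_le _ _)); rewrite ler_wpM2r ?dot_ge0// ler_wpM2l.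
have qG z : qf G z <= nK * dot z z.
  apply: (le_trans (ler_norm _)); apply: (le_trans (qf_abs_le _ _)).
  by rewrite ler_wpM2r ?dot_ge0// ler_wpM2l.
pose M := C^T *m invmx Q *m C; pose N := B *m W *m B^T.
have M0 z : 0 <= qf M z.
  by rewrite /M -{2}(trmxK C) qf_conj spd_invmx_qf_ge0.
have N0 z : 0 <= qf N z by rewrite qf_conj spd_qf_ge0.
have qM z : qf M z <= mC * dot z z.
  apply: (le_trans (ler_norm _)); apply: (le_trans (qf_abs_le _ _)).
  rewrite ler_wpM2r ?dot_ge0// ler_wpM2l//.
  by do 2?apply: mx_normM_le2; rewrite ?mx_norm_tr.
have qN z : qf N z <= mB * dot z z.
  apply: (le_trans (ler_norm _)); apply: (le_trans (qf_abs_le _ _)).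
  rewrite ler_wpM2r ?dot_ge0// ler_wpM2l//.
  by do 2?apply: mx_normM_le2; rewrite ?mx_norm_tr.
have tT1 (t : R) : t \in `]0, T[ -> t \in `[0, T].
  by rewrite !in_itv/= => /andP[/ltW-> /ltW->].
have cE (a k : R) : {within `[0, T], continuous
    (fun u => (a * expR (k * u))%:M : 'M[R]_n)}.
  apply: within_continuous_scalar_mx; apply: continuous_subspaceT => x.
  by apply: cvgM; [exact: cvg_cst|exact: continuous_expRM].
have dE (a k t : R) : is_derive t 1 (fun u => (a * expR (k * u))%:M : 'M[R]_n)
    (k * (a * expR (k * t)))%:M.
  apply: is_derive_scalar_mx.
  apply: is_derive_ext (is_deriveZ a (is_derive_expRM k t)) _ _ => //.
  by rewrite /GRing.scale/=; ring.
(* In a kernel direction of the gap, [z] is an eigenvector of [Pi t] for the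
   value [mu] of the barrier. *)
have eig (mu : R) (P : 'M[R]_n) z : P *m z = mu%:M *m z -> P *m z = mu *: z.
  by rewrite mul_scalar_mx.
have lower (t : R) : t \in `[0, T] ->
    forall z, 0 <= qf (Pi t - (d0 * expR (- L * t))%:M) z.
  apply: (psd_barrier (H := fun u => Pi u - (d0 * expR (- L * u))%:M)
    (H' := fun u => riccati_field A W Q (Pi u) - (- L * (d0 * expR (- L * u)))%:M)).
  - exact: T0.
  - exact: within_continuousB cPi (cE _ _).
  - by move=> u uT; rewrite linearB/= sPi// tr_scalar_mx.
  - move=> z z0; rewrite mulr0 expR0 mulr1 Pi0 qfD qfN qf_scalar subr_gt0.
    have := spd_qf_lower z sG GVK; rewrite -/nK => zG.
    have zz := dot_gt0 z0; rewrite /d0 -ltr_pdivlMl ?invr_gt0 ?invrK; last by lra.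
    have := spd_qf sG z0; nra.
  - by move=> u uT; exact: is_deriveB (dPi _ uT) (dE _ _ _).
  - move=> u uT z z0 /eqP; rewrite mulmxBl subr_eq0 => /eqP/eig Pz.
    rewrite qfD qfN qf_scalar (qf_riccati_field _ _ _ (sPi _ (tT1 _ uT)) Pz) -/M -/N.
    set mu := d0 * _ in Pz *.
    have mu0 : 0 < mu by rewrite mulr_gt0 ?expR_gt0.
    have mu1 : mu <= 1.
      rewrite /mu -[leRHS]mulr1 ler_pM ?expR_ge0 ?(ltW d00)//.
      rewrite -expR0 ler_expR.
      move: uT; rewrite in_itv/= => /andP[u0 _].
      by rewrite mulNr oppr_le0 mulr_ge0// ltW.
    have zz := mulr_gt0 mu0 (dot_gt0 z0).
    have h1 : - (mu * (nK * dot z z)) <= mu * qf A z.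
      rewrite -mulrN ler_wpM2l ?(ltW mu0)//.
      by have := qA z; rewrite ler_norml => /andP[].
    have h2 : mu ^+ 2 * qf M z <= mu * (mC * dot z z).
      rewrite expr2 -mulrA ler_wpM2l ?(ltW mu0)//.
      by apply: le_trans (qM z); rewrite ler_piMl.
    have h3 := mulr_ge0 mB0 (ltW zz).
    have := N0 z; rewrite /L; nra.
have upper (t : R) : t \in `[0, T] ->
    forall z, 0 <= qf ((b0 * expR (L * t))%:M - Pi t) z.
  apply: (psd_barrier (H := fun u => (b0 * expR (L * u))%:M - Pi u)
    (H' := fun u => (L * (b0 * expR (L * u)))%:M - riccati_field A W Q (Pi u))).
  - exact: T0.
  - exact: within_continuousB (cE _ _) cPi.
  - by move=> u uT; rewrite linearB/= sPi// tr_scalar_mx.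
  - move=> z z0; rewrite mulr0 expR0 mulr1 Pi0 qfD qfN qf_scalar subr_gt0.
    have := qG z; have := dot_gt0 z0; rewrite /b0; nra.
  - by move=> u uT; exact: is_deriveB (dE _ _ _) (dPi _ uT).
  - move=> u uT z z0 /eqP; rewrite mulmxBl subr_eq0 eq_sym => /eqP/eig Pz.
    rewrite qfD qfN qf_scalar (qf_riccati_field _ _ _ (sPi _ (tT1 _ uT)) Pz) -/M -/N.
    set mu := b0 * _ in Pz *.
    have mu1 : 1 <= mu.
      rewrite /mu -[leLHS]mulr1 ler_pM// -expR0 ler_expR.
      by move: uT; rewrite in_itv/= => /andP[u0 _]; rewrite mulr_ge0// ltW.
    have mu0 : 0 < mu by exact: lt_le_trans mu1.
    have zz := mulr_gt0 mu0 (dot_gt0 z0).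
    have h1 : mu * qf A z <= mu * (nK * dot z z).
      by rewrite ler_wpM2l ?(ltW mu0)// (le_trans (ler_norm _)).
    have h2 : 0 <= mu ^+ 2 * qf M z by rewrite mulr_ge0// sqr_ge0.
    have h3 : qf N z <= mu * (mB * dot z z).
      by rewrite (le_trans (qN z))// ler_peMl// mulr_ge0// dot_ge0.
    have h4 := mulr_ge0 mC0 (ltW zz).
    rewrite /L; nra.
move=> t tT; have /andP[t0 tT'] : 0 <= t <= T by move: tT; rewrite in_itv.
split=> [|z|z]; first exact: sPi.
- have := lower _ tT z; rewrite qfD qfN qf_scalar subr_ge0; apply: le_trans.
  rewrite ler_wpM2r ?dot_ge0// ler_wpM2l ?(ltW d00)// ler_expR.
  by rewrite !mulNr lerN2 ler_wpM2l// ltW.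
- have := upper _ tT z; rewrite qfD qfN qf_scalar subr_ge0 => /le_trans; apply.
  rewrite ler_wpM2r ?dot_ge0// ler_wpM2l ?(le_trans ler01)// ler_expR.
  by rewrite ler_wpM2l// ltW.
Qed.

End Riccati.

(** * Lipschitz dependence of the coefficients *)

Section Lipschitz.
Context {R : realType} (T : R) (T0 : 0 < T) (n m r : nat).
Context (B : 'M[R]_(n, m)) (C : 'M[R]_(r, n)).

Definition near_data (d : R) (S S' : quad R n m r) : Prop :=
  let: (A, G, W, Q) := S in let: (A', G', W', Q') := S' in
  [/\ `|A - A'| <= d, `|G - G'| <= d, `|W - W'| <= d & `|Q - Q'| <= d].

Lemma close_of_dist (d c : R) p q (M M' : 'M[R]_(p, q)) : 0 <= d -> 1 <= c ->
  `|M| <= c -> `|M'| <= c -> `|M - M'| <= d -> close c d M M'.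
Proof. by move=> d0 c1 Mc M'c MM'; split=> //; rewrite (le_trans MM')// ler_peMl. Qed.

(** The constant is the one computed by the rules for [close]; it is left to
    unification. *)
Lemma riccati_field_close (a w k b : R) : exists c : R,
  forall (d : R) A A' W W' Q Q' P P', 0 <= d ->
  close a d A A' -> close w d W W' -> close k d (invmx Q) (invmx Q') ->
  close b d P P' ->
  close c d (riccati_field B C A W Q P) (riccati_field B C A' W' Q' P').
Proof.
eexists => d A A' W W' Q Q' P P' d0 cA cW cQ cP.
have cB := close_refl B d0; have cC := close_refl C d0.
apply: closeD (closeM (closeM cB cW) (close_tr cB)).
apply: closeD (closeD (closeM cA cP) (closeM cP (close_tr cA))) (closeN _).
exact: closeM (closeM (closeM (closeM cP (close_tr cC)) cQ) cC) cP.
Qed.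

(** Gronwall for the difference of two solutions. At each time, [close] is
    applied with the distance [e + d], where [d] bounds the distance of the data
    and [e] is the current distance of the solutions. *)
Lemma riccati_lipschitz K : 1 <= K -> exists2 c, 1 <= c &
  forall S S' Pi Pi' d, 0 <= d -> tame K S -> tame K S' -> near_data d S S' ->
    riccati_solution T B C S Pi -> riccati_solution T B C S' Pi' ->
    forall t : R, t \in `[0, T] -> close c d (Pi t) (Pi' t).
Proof.
move=> K1; have K0 : 0 <= K by exact: le_trans K1.
have [dl [b [dl0 b0 bnd]]] := riccati_qf_bounds T0 B C K0.
pose b1 := b + 1; have b11 : 1 <= b1 by rewrite lerDr ltW.
have Pib S Pi : tame K S -> riccati_solution T B C S Pi ->
    forall t : R, t \in `[0, T] -> `|Pi t| <= b1.
  move: S => [[[A G] W] Q] tS sS t tT.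
  have [sPi lo up] := bnd _ _ _ _ _ tS sS _ tT.
  apply: (@le_trans _ _ b); last by rewrite lerDl.
  apply: mx_norm_le_qf => //; first exact: ltW.
  by move=> z; apply: le_trans (lo z); rewrite mulr_ge0 ?dot_ge0// ltW.
have [c0 fclose] := riccati_field_close K K (K + r%:R * (r%:R * K) * K) b1.
have c00 : 0 <= `|c0| by [].
have [g g0 gron] := gronwall_mx n n c00 (ltW T0).
exists (Num.max b1 (g * (1 + `|c0|))); first by rewrite le_max b11.
move=> S S' Pi Pi' d d0 tS tS' SS' sS sS' t tT.
split; [by rewrite le_max (Pib _ _ tS sS)|by rewrite le_max (Pib _ _ tS' sS')|].
apply: (@le_trans _ _ (g * (1 + `|c0|) * d)); last first.
  by rewrite ler_wpM2r// le_max lexx orbT.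
have Pib1 := Pib _ _ tS sS; have Pib2 := Pib _ _ tS' sS'.
move: S S' tS tS' SS' sS sS' => [[[A G] W] Q] [[[A' G'] W'] Q'].
move=> [[_ _ sQ] AK [GK _] WK QK] [[_ _ sQ'] AK' [GK' _] WK' QK'].
move=> [AA GG WW QQ] [cPi Pi0 dPi] [cPi' Pi0' dPi'].
have cd0 : 0 <= `|c0| * d by rewrite mulr_ge0.
have := gron _ (fun u => Pi u - Pi' u) (fun u => riccati_field B C A W Q (Pi u)
  - riccati_field B C A' W' Q' (Pi' u)) cd0 (within_continuousB cPi cPi').
have dD (u : R) : u \in `]0, T[ -> is_derive u 1 (fun u => Pi u - Pi' u)
    (riccati_field B C A W Q (Pi u) - riccati_field B C A' W' Q' (Pi' u)).
  by move=> uT; exact: is_deriveB (dPi _ uT) (dPi' _ uT).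
move=> /(_ dD) gr; apply: le_trans (gr _ _ tT) _; last first.
  rewrite -mulrA ler_wpM2l// mulrDl mul1r lerD2r.
  by rewrite Pi0 Pi0'.
move=> u uT; have {}uT : u \in `[0, T].
  by move: uT; rewrite !in_itv/= => /andP[/ltW-> /ltW->].
rewrite -mulrDr.
set e := `|Pi u - Pi' u|; have e0 : 0 <= e := normr_ge0 _.
have de0 : 0 <= e + d by rewrite addr_ge0.
have ded : d <= e + d by rewrite lerDr.
have [_ _] : close c0 (e + d) (riccati_field B C A W Q (Pi u))
    (riccati_field B C A' W' Q' (Pi' u)).
  apply: fclose => //.
  - by apply: close_of_dist => //; exact: le_trans AA ded.
  - by apply: close_of_dist => //; exact: le_trans WW ded.
  - by apply: close_inv => //; [exact: spd_unitmx|exact: spd_unitmx|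
      exact: le_trans QQ ded].
  - by apply: close_of_dist => //; [exact: Pib1|exact: Pib2|rewrite lerDl].
by move=> /le_trans; apply; rewrite ler_wpM2r// ler_norm.
Qed.

Notation mu := (@lebesgue_measure R).

Definition gain (P : 'M[R]_n) (Q : 'M[R]_r) : 'M[R]_(n, r) :=
  P *m C^T *m invmx Q.

(** The closed-loop matrix: the observer equation is affine in its state with
    this linear part and with the forcing term [gain P Q *m y]. *)
Definition drift (A P : 'M[R]_n) (Q : 'M[R]_r) : 'M[R]_n :=
  A - gain P Q *m C.

Lemma coefficients_close K : 1 <= K -> exists2 c, 1 <= c &
  forall (A A' : 'M[R]_n) G G' (W W' : 'M[R]_m) Q Q' Pi Pi' d, 0 <= d ->
    tame K (A, G, W, Q) -> tame K (A', G', W', Q') ->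
    near_data d (A, G, W, Q) (A', G', W', Q') ->
    riccati_solution T B C (A, G, W, Q) Pi ->
    riccati_solution T B C (A', G', W', Q') Pi' ->
    forall t : R, t \in `[0, T] ->
    close c d (drift A (Pi t) Q) (drift A' (Pi' t) Q') /\
    close c d (gain (Pi t) Q) (gain (Pi' t) Q').
Proof.
move=> K1; have [c c1 Pic] := riccati_lipschitz K1.
have [cg cgP] : exists cg : R, forall d P P' Q Q', 0 <= d ->
    close c d P P' ->
    close (K + r%:R * (r%:R * K) * K) d (invmx Q) (invmx Q') ->
    close cg d (gain P Q) (gain P' Q').
  eexists => d P P' Q Q' d0 cP cQ.
  exact: closeM (closeM cP (close_tr (close_refl C d0))) cQ.
have [cf cfP] : exists cf : R, forall d A A' P P' Q Q', 0 <= d ->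
    close K d A A' -> close cg d (gain P Q) (gain P' Q') ->
    close cf d (drift A P Q) (drift A' P' Q').
  eexists => d A A' P P' Q Q' d0 cA cG.
  exact: closeD cA (closeN (closeM cG (close_refl C d0))).
exists (Num.max 1 (Num.max cf cg)); first by rewrite le_max lexx.
move=> A A' G G' W W' Q Q' Pi Pi' d d0 tS tS' SS' sS sS' t tT.
have cPi := Pic _ _ _ _ _ d0 tS tS' SS' sS sS' t tT.
move: tS tS' SS' => [[_ _ sQ] AK _ _ QK] [[_ _ sQ'] AK' _ _ QK'] [AA _ _ QQ].
have cG := cgP _ _ _ Q Q' d0 cPi _.
have {}cG : close cg d (gain (Pi t) Q) (gain (Pi' t) Q').
  by apply: cG; apply: close_inv => //; exact: spd_unitmx.
have cA : close K d A A' by exact: close_of_dist.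
have cF := cfP _ _ _ _ _ _ _ d0 cA cG.
by split; [apply: close_le cF|apply: close_le cG] => //;
  rewrite !le_max lexx !orbT.
Qed.

(** * Integrability of the observer equation *)

Lemma integrable_cont_mul (f g : R -> R) : {within `[0, T], continuous f} ->
  mu.-integrable `[0, T] (EFin \o g) ->
  mu.-integrable `[0, T] (EFin \o (fun s => f s * g s)).
Proof.
move=> cf ig.
rewrite (_ : _ \o _ = (EFin \o f) \* (EFin \o g))%E//.
apply: integrableMr => //.
  have cif : mu.-integrable `[0, T] (EFin \o f).
    by apply: continuous_compact_integrable => //; exact: segment_compact.
  by have /integrableP[/measurable_EFinP] := cif.
have /compact_bounded[M [_ fM]] := continuous_compact cf (@segment_compact _ 0 T).
by exists M; split; rewrite ?num_real// => x Mx u uT; apply: fM => //; exists u.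
Qed.

Lemma integrable_sum_ord p (f : 'I_p -> R -> R) :
  (forall i, mu.-integrable `[0, T] (EFin \o f i)) ->
  mu.-integrable `[0, T] (EFin \o (fun s => \sum_(i < p) f i s)).
Proof.
move=> fi; rewrite (_ : _ \o _ = (fun s => \sum_(i < p) (f i s)%:E)%E).
  by apply: integrable_sum => // i _; exact: fi.
by apply/funext => s /=; rewrite sumEFin.
Qed.

Lemma integrable_mulmx p (F : R -> 'M[R]_(n, p)) (v : R -> 'cV[R]_p) i :
  {within `[0, T], continuous F} ->
  (forall j, mu.-integrable `[0, T] (EFin \o (fun s => v s j 0))) ->
  mu.-integrable `[0, T] (EFin \o (fun s => (F s *m v s) i 0)).
Proof.
move=> cF vi.
rewrite (_ : _ \o _ = EFin \o (fun s => \sum_j F s i j * v s j 0)); last first.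
  by apply/funext => s /=; rewrite mxE.
apply: integrable_sum_ord => j; apply: integrable_cont_mul (vi j).
by move=> x; have /cvg_mxP := cF x; exact.
Qed.

(** The bound [x <= 1 + x ^+ 2] suffices on an interval of finite length. *)
Lemma square_integrable_integrable (y : R -> 'cV[R]_r) : square_integrable T y ->
  forall j, mu.-integrable `[0, T] (EFin \o (fun s => y s j 0)).
Proof.
move=> [my y2] j; pose g (s : R) : R := 1 + enorm2 (y s) ^+ 2.
have my2 : measurable_fun `[0, T] (fun s : R => enorm2 (y s) ^+ 2).
  rewrite (_ : (fun s => _) = (fun s => \sum_i y s i 0 * y s i 0)).
    by apply: measurable_sum => i; apply: measurable_funM; exact: my.
  by apply/funext => s; rewrite enorm2E sqr_sqrtr ?dot_ge0// dotE.
have iy2 : mu.-integrable `[0, T] (EFin \o (fun s => enorm2 (y s) ^+ 2)).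
  apply/integrableP; split; first exact/measurable_EFinP.
  apply: le_lt_trans y2; rewrite le_eqVlt; apply/orP; left; apply/eqP.
  apply: eq_integral => s _ /=.
  by rewrite ger0_norm// sqr_ge0.
have ig : mu.-integrable `[0, T] (EFin \o g).
  rewrite (_ : _ \o _ =
    (EFin \o cst 1%R) \+ (EFin \o (fun s : R => (enorm2 (y s) ^+ 2)%R)))%E//.
  apply: integrableD => //; apply: continuous_compact_integrable.
    exact: segment_compact.
  by apply: continuous_subspaceT => x; exact: cvg_cst.
apply: le_integrable ig => //; first by apply/measurable_EFinP; exact: my.
move=> s _ /=; rewrite lee_fin [leRHS]ger0_norm ?addr_ge0 ?sqr_ge0//.
have := le_trans (ler_mx_norm_entry (y s) j 0) (mx_norm_le_enorm2 (y s)).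
by have := sqr_ge0 (enorm2 (y s) - 1); rewrite /g; nra.
Qed.

End Lipschitz.

(** * Lipschitz dependence of the observer *)

Section Observer.
Context {R : realType} (T : R) (T0 : 0 < T) (n m r : nat).
Context (B : 'M[R]_(n, m)) (C : 'M[R]_(r, n)).
Context (x0 : 'cV[R]_n) (y : R -> 'cV[R]_r) (hy : square_integrable T y).

Notation mu := (@lebesgue_measure R).

Definition observer_field (A P : 'M[R]_n) (Q : 'M[R]_r) (x : 'cV[R]_n)
    (w : 'cV[R]_r) : 'cV[R]_n :=
  drift C A P Q *m x + gain C P Q *m w.

Lemma observer_fieldE A P Q x w :
  A *m x + P *m C^T *m invmx Q *m (w - C *m x) = observer_field A P Q x w.
Proof.
rewrite /observer_field /drift /gain mulmxBl mulmxBr -!mulmxA.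
by rewrite addrA addrAC.
Qed.

(** A sum rather than the maximum norm, because its integrability is immediate. *)
Definition signal_size (s : R) : R := \sum_(j < r) `|y s j 0|.

Lemma signal_size_ge0 s : 0 <= signal_size s.
Proof. by apply: sumr_ge0. Qed.

Lemma mx_norm_signal s : `|y s| <= signal_size s.
Proof.
apply: mx_norm_le => [|i j]; first exact: signal_size_ge0.
by rewrite ord1 /signal_size (bigD1 i)//= lerDl sumr_ge0.
Qed.

Lemma integrable_signal_size : mu.-integrable `[0, T] (EFin \o signal_size).
Proof.
apply: integrable_sum_ord => j.
by apply: integrable_norm; exact: square_integrable_integrable.
Qed.

Lemma integrable_affine_signal (a b : R) :
  mu.-integrable `[0, T] (EFin \o (fun s => a + b * signal_size s)).
Proof.
have cab (k : R) : {within `[0, T], continuous (fun _ : R => k)}.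
  by apply: continuous_subspaceT => x; exact: cvg_cst.
rewrite (_ : _ \o _ = (EFin \o (fun=> a)) \+
  (EFin \o (fun s : R => (b * signal_size s)%R)))%E//.
apply: integrableD => //.
  by apply: continuous_compact_integrable; [exact: segment_compact|exact: cab].
by apply: integrable_cont_mul; [exact: cab|exact: integrable_signal_size].
Qed.

Lemma integrable_observer_field A G W Q Pi (x : R -> 'cV[R]_n) i :
  riccati_solution T B C (A, G, W, Q) Pi -> {within `[0, T], continuous x} ->
  mu.-integrable `[0, T]
    (EFin \o (fun s => observer_field A (Pi s) Q (x s) (y s) i 0)).
Proof.
move=> [cPi _ _] cx.
have cc p q (M : 'M[R]_(p, q)) : {within `[0, T], continuous (fun _ : R => M)}.
  by apply: continuous_subspaceT => u; exact: cvg_cst.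
have cg : {within `[0, T], continuous (fun s => gain C (Pi s) Q)}.
  by do 2?apply: within_continuous_mulmx.
rewrite (_ : _ \o _ =
  ((EFin \o (fun s => (drift C A (Pi s) Q *m x s) i 0%R)) \+
  (EFin \o (fun s => (gain C (Pi s) Q *m y s) i 0%R)))%E); last first.
  by apply/funext => s /=; rewrite mxE.
apply: integrableD => //; apply: integrable_mulmx => //.
- by apply: within_continuousB; [exact: cc|exact: within_continuous_mulmx].
- move=> j; apply: continuous_compact_integrable; first exact: segment_compact.
  by move=> u; have /cvg_mxP := cx u; exact.
- exact: square_integrable_integrable.
Qed.

Lemma observer_bound K : 1 <= K -> exists2 X, 0 <= X &
  forall (S : quad R n m r) Pi x, tame K S -> riccati_solution T B C S Pi ->
    observer_solution T C x0 y S Pi x ->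
    forall t : R, t \in `[0, T] -> `|x t| <= X.
Proof.
move=> K1; have [c c1 cP] := coefficients_close T0 B C K1.
have c0 : 0 <= c by exact: le_trans c1.
pose k := n%:R * c; have k0 : 0 <= k by rewrite mulr_ge0.
(* The zero summand gives [g] the shape of [integrable_affine_signal]. *)
pose g s := 0 + r%:R * c * signal_size s.
exists ((1 + k * T * expR (k * T)) * (`|x0| + \int[mu]_(s in `[0, T]) g s)).
  rewrite mulr_ge0 ?addr_ge0 ?mulr_ge0 ?expR_ge0// ?(ltW T0)//.
  by apply: Rintegral_ge0 => s _; rewrite /g add0r !mulr_ge0 ?signal_size_ge0.
move=> [[[A G] W] Q] Pi x tS sS [cx xE].
have SS : near_data 0 (A, G, W, Q) (A, G, W, Q).
  by split; rewrite subrr normr0.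
apply: (gronwall_caratheodory
  (h := fun s => observer_field A (Pi s) Q (x s) (y s))) => //.
- by move=> i; exact: integrable_observer_field sS cx.
- exact: integrable_affine_signal.
- move=> s sT.
  have [[cF _ _] [cG _ _]] := cP _ _ _ _ _ _ _ _ _ _ _ (lexx _) tS tS SS sS sS s sT.
  apply: (le_trans (ler_normD _ _)); rewrite /g add0r; apply: lerD.
    exact: mx_normM_le2.
  by apply: mx_normM_le2 => //; exact: mx_norm_signal.
- by move=> s _; rewrite /g add0r !mulr_ge0 ?signal_size_ge0.
- move=> t tT i; rewrite (xE _ tT).
  under eq_Rintegral do rewrite observer_fieldE.
  apply: (le_trans (ler_normD _ _)); rewrite lerD2r.
  exact: ler_mx_norm_entry.
Qed.

(** The difference of two observers solves an equation of the same type, forced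
    by the differences of the coefficients applied to the bounded state and to
    the integrable signal. *)
Lemma observer_lipschitz K : 1 <= K -> exists2 c, 0 <= c &
  forall (S S' : quad R n m r) Pi Pi' x x' d, 0 <= d ->
    tame K S -> tame K S' -> near_data d S S' ->
    riccati_solution T B C S Pi -> riccati_solution T B C S' Pi' ->
    observer_solution T C x0 y S Pi x -> observer_solution T C x0 y S' Pi' x' ->
    forall t : R, t \in `[0, T] -> `|x t - x' t| <= c * d.
Proof.
move=> K1; have [X X0 xX] := observer_bound K1.
have [c c1 cP] := coefficients_close T0 B C K1.
have c0 : 0 <= c by exact: le_trans c1.
pose k := n%:R * c; have k0 : 0 <= k by rewrite mulr_ge0.
pose f s := n%:R * c * X + r%:R * c * signal_size s.
have f0 s : 0 <= f s by rewrite addr_ge0 ?mulr_ge0 ?signal_size_ge0.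
have fi : mu.-integrable `[0, T] (EFin \o f) by exact: integrable_affine_signal.
exists ((1 + k * T * expR (k * T)) * \int[mu]_(s in `[0, T]) f s).
  rewrite mulr_ge0 ?addr_ge0 ?mulr_ge0 ?expR_ge0// ?(ltW T0)//.
  exact: Rintegral_ge0.
move=> [[[A G] W] Q] [[[A' G'] W'] Q'] Pi Pi' x x' d d0 tS tS' SS' sS sS'.
move=> [cx xE] [cx' xE'] t tT.
pose h s := observer_field A (Pi s) Q (x s) (y s).
pose h' s := observer_field A' (Pi' s) Q' (x' s) (y s).
have hi i : mu.-integrable `[0, T] (EFin \o (fun s => h s i 0)).
  exact: integrable_observer_field sS cx.
have hi' i : mu.-integrable `[0, T] (EFin \o (fun s => h' s i 0)).
  exact: integrable_observer_field sS' cx'.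
have sub (u : R) : u \in `[0, T] -> `[0, u]%classic `<=` `[0, T]%classic.
  by rewrite in_itv/= => /andP[_ uT]; apply: subset_itvl; rewrite bnd_simp.
have -> : (1 + k * T * expR (k * T)) * \int[mu]_(s in `[0, T]) f s * d =
    (1 + k * T * expR (k * T)) * (0 + \int[mu]_(s in `[0, T]) (f s * d)).
  by rewrite add0r RintegralZr// mulrA.
apply: (gronwall_caratheodory (e := fun s => x s - x' s)
  (h := fun s => h s - h' s)) => //.
- exact: within_continuousB cx cx'.
- move=> i; rewrite (_ : _ \o _ = ((EFin \o (fun s => h s i 0%R)) \-
    (EFin \o (fun s => h' s i 0%R)))%E).
    by apply: integrableB.
  by apply/funext => s /=; rewrite !mxE.
- rewrite (_ : _ \o _ = (fun s => d%:E * (f s)%:E)%E); first exact: integrableZl.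
  by apply/funext => s /=; rewrite mulrC.
- move=> s sT.
  have [[cF _ FF] [_ _ GG]] := cP _ _ _ _ _ _ _ _ _ _ _ d0 tS tS' SS' sS sS' s sT.
  have {}xX := xX _ _ _ tS' sS' (conj cx' xE') _ sT.
  have -> : h s - h' s = drift C A (Pi s) Q *m (x s - x' s) +
      ((drift C A (Pi s) Q - drift C A' (Pi' s) Q') *m x' s +
       (gain C (Pi s) Q - gain C (Pi' s) Q') *m y s).
    rewrite /h /h' /observer_field mulmxBr !mulmxBl.
    by apply/matrixP => i j; rewrite !mxE; ring.
  apply: (le_trans (ler_normD _ _)); apply: lerD; first exact: mx_normM_le2.
  apply: (le_trans (ler_normD _ _)); rewrite /f mulrDl; apply: lerD.
    by rewrite mulrAC -[n%:R * c * d]mulrA; exact: mx_normM_le2.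
  rewrite mulrAC -[r%:R * c * d]mulrA; apply: mx_normM_le2 => //.
  exact: mx_norm_signal.
- by move=> s _; rewrite mulr_ge0.
- move=> u uT i; rewrite add0r mxE [X in _ + X]mxE (xE _ uT) (xE' _ uT).
  under eq_Rintegral do rewrite observer_fieldE.
  under [X in _ - (_ + X)]eq_Rintegral do rewrite observer_fieldE.
  rewrite opprD addrACA subrr add0r -RintegralB//; last 2 first.
  - by apply: integrableS (hi i) => //; exact: sub.
  - by apply: integrableS (hi' i) => //; exact: sub.
  rewrite le_eqVlt; apply/orP; left; apply/eqP; congr `|_|.
  by apply: eq_Rintegral => s _; rewrite !mxE.
Qed.

End Observer.

(** * Averaging *)

Section Mean.
Context {R : realType} (I : choiceType).

Lemma mean_sub_le n (D : {fset I}) (f : I -> 'cV[R]_n) z (g : I -> R) c s0 :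
  s0 \in D -> (forall s, s \in D -> `|f s - z| <= c * g s) ->
  `|mean D f - z| <= c * mean D (g : I -> R^o).
Proof.
move=> s0D fz; pose N : R := (#|` D|)%:R.
have N0 : 0 < N by rewrite ltr0n cardfs_gt0; apply/fset0Pn; exists s0.
have -> : mean D f - z = N^-1 *: \sum_(s <- D) (f s - z).
  rewrite sumrB scalerBr big_const_seq count_predT iter_addr_0 -/N.
  by rewrite -[z *+ _]scaler_nat scalerA mulVf ?gt_eqF// scale1r.
rewrite normrZ gtr0_norm ?invr_gt0//.
rewrite /mean [_ *: (_ : R^o)]/GRing.scale/= [leRHS]mulrCA ler_wpM2l ?invr_ge0 ?(ltW N0)//.
rewrite mulr_sumr (le_trans (ler_norm_sum _ _ _))//.
by rewrite big_seq [leRHS]big_seq; apply: ler_sum => s; exact: fz.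
Qed.

End Mean.

(* The constant is chosen after T, B, C, x0, y and the common bound K on the
   matrices, but before the parameter set (hence before its cardinality N). *)
Theorem proposition4p8 (R : realType) (T : R) (hT : 0 < T) (n m r : nat)
    (B : 'M[R]_(n, m)) (C : 'M[R]_(r, n)) (x0 : 'cV[R]_n)
    (y : R -> 'cV[R]_r) (hy : square_integrable T y) (K : R) :
  exists c : R, 0 < c /\
    forall (pA pG pW pQ : nat)
      (SA : {fset 'rV[R]_pA}) (SG : {fset 'rV[R]_pG})
      (SW : {fset 'rV[R]_pW}) (SQ : {fset 'rV[R]_pQ})
      (A : 'rV[R]_pA -> 'M[R]_n) (G : 'rV[R]_pG -> 'M[R]_n)
      (W : 'rV[R]_pW -> 'M[R]_m) (Q : 'rV[R]_pQ -> 'M[R]_r)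
      (Pi : param R pA pG pW pQ -> R -> 'M[R]_n)
      (xhat : param R pA pG pW pQ -> R -> 'cV[R]_n),
    let Sigma := param_set SA SG SW SQ in
    let S := quad_of A G W Q in
    (forall s, s \in Sigma -> admissible (S s)) ->
    (forall s, s \in Sigma -> bounded_quad K (S s)) ->
    (forall s, s \in Sigma -> riccati_solution T B C (S s) (Pi s)) ->
    (forall s, s \in Sigma ->
       observer_solution T C x0 y (S s) (Pi s) (xhat s)) ->
    forall sbar, sbar \in Sigma ->
    forall t : R, t \in `[0, T] ->
      wnorm (invmx (Pi sbar t))
            (mean Sigma (fun s => xhat s t) - xhat sbar t)
      <= c * mean Sigma (fun s => norm1 (S s - S sbar) : R^o).
Proof.
pose K1 := `|K| + 1; have K11 : 1 <= K1 by rewrite lerDr.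
have K10 : 0 <= K1 by exact: le_trans K11.
have [dl [b [dl0 _ bnd]]] := riccati_qf_bounds hT B C K10.
have [c c0 xlip] := observer_lipschitz hT B C x0 hy K11.
have nd0 : 0 <= n%:R / dl by rewrite divr_ge0// ltW.
pose sn := Num.sqrt (n%:R / dl); have sn0 : 0 <= sn by exact: sqrtr_ge0.
(* The product alone may vanish. *)
exists (sn * c + 1); split; first by rewrite ltr_wpDl ?mulr_ge0.
move=> pA pG pW pQ SA SG SW SQ A G W Q Pi xhat Sigma S adm bnK solPi solx.
move=> sbar sbarS t tT.
have tameS s : s \in Sigma -> tame K1 (S s).
  by move=> sS; apply: tame_of_bounded; [exact: adm|exact: bnK].
have norm1_ge0 s : 0 <= norm1 (S s - S sbar).
  move: (S s - S sbar) => [[[? ?] ?] ?] /=.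
  by rewrite !addr_ge0// opnorm2_ge0.
have xle s : s \in Sigma ->
    `|xhat s t - xhat sbar t| <= c * norm1 (S s - S sbar).
  move=> sS; apply: (xlip _ _ _ _ _ _ _ _ (tameS _ sS) (tameS _ sbarS) _
    (solPi _ sS) (solPi _ sbarS) (solx _ sS) (solx _ sbarS) _ tT) => //.
  case: (S s) (S sbar) => [[[A1 G1] W1] Q1] [[[A2 G2] W2] Q2].
  have -> : norm1 ((A1, G1, W1, Q1) - (A2, G2, W2, Q2)) =
    opnorm2 (A1 - A2) + opnorm2 (G1 - G2) + opnorm2 (W1 - W2) + opnorm2 (Q1 - Q2).
    by [].
  have := opnorm2_ge0 (A1 - A2); have := opnorm2_ge0 (G1 - G2).
  have := opnorm2_ge0 (W1 - W2); have := opnorm2_ge0 (Q1 - Q2).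
  by split; apply: (le_trans (mx_norm_le_opnorm2 _)); lra.
have mle := mean_sub_le sbarS xle.
have m0 : 0 <= mean Sigma (fun s => norm1 (S s - S sbar) : R^o).
  by rewrite /mean mulr_ge0 ?invr_ge0// sumr_ge0.
set z := mean _ _ - _ in mle *.
have zP : wnorm (invmx (Pi sbar t)) z <= sn * `|z|.
  rewrite /wnorm -qf_wide -(normr_id z) -sqrtr_sqr -sqrtrM//.
  rewrite ler_sqrt; last exact: mulr_ge0 nd0 (sqr_ge0 _).
  move: (tameS _ sbarS) (solPi _ sbarS); rewrite /z; case: (S sbar) => [[[? ?] ?] ?].
  move=> tS sS; have [sPi lo _] := bnd _ _ _ _ _ tS sS t tT.
  apply: (le_trans (qf_invmx_le _ sPi dl0 lo)).
  by rewrite mulrAC ler_wpM2r ?invr_ge0 ?(ltW dl0)// dot_le_mx_norm_sqr.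
apply: (le_trans zP); apply: (le_trans (ler_wpM2l sn0 mle)).
by rewrite mulrA mulrDl mul1r lerDl.
Qed.
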